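(* With $A=\Bbbk Q/I$, the ambiguity sets $S_n$, and the $(A,A)$-bimodules $P_n=A\otimes \Bbbk S_n\otimes A$ described in the context, the complex $$\cdots \xrightarrow{\partial _{n+1}}P_n\xrightarrow{\partial _n}P_{n-1}\xrightarrow{\partial _{n-1}}\cdots \xrightarrow{\partial _2}P_1\xrightarrow{\partial _1}P_0\xrightarrow{\partial _0}A\rightarrow 0$$ is a projective resolution of the diagonal $(A,A)$-bimodule $A$, where the $\partial_n$ are the bimodule maps determined by the following formulas (for all $0\le i\le N-1$). For $n=0,1$: $\partial_0(1\otimes 1)=1$ (multiplication), and $\partial_1(1\otimes w\otimes 1)=1\otimes w-w\otimes 1$ for all $w\in Q_1$. For even $n\ge 2$: $$\begin{aligned} \partial_n(1\otimes Q^n_i\otimes 1)&=1\otimes Q^{n-1}_i\otimes p_{i+1}+q_i\otimes P^{n-1}_{i+1}\otimes 1-1\otimes sQ^{n-1}_i\otimes 1,\\ \partial_n(1\otimes P^n_{i+1}\otimes 1)&=1\otimes P^{n-1}_{i+1}\otimes q_i+p_{i+1}\otimes Q^{n-1}_i\otimes 1-1\otimes sP^{n-1}_{i+1}\otimes 1,\\ \partial_n(1\otimes sP^n_{i+1}\otimes 1)&=1\otimes sP^{n-1}_{i+1}\otimes p_{i+1}+s_{i+1}\otimes P^{n-1}_{i+1}\otimes 1-p_{i+1}\otimes sQ^{n-1}_i\otimes 1-1\otimes P^{n-1}_{i+1}\otimes s_i,\\ \partial_n(1\otimes sQ^n_i\otimes 1)&=1\otimes sQ^{n-1}_i\otimes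 q_i+s_i\otimes Q^{n-1}_i\otimes 1-q_i\otimes sP^{n-1}_{i+1}\otimes 1-1\otimes Q^{n-1}_i\otimes s_{i+1}. \end{aligned}$$ For odd $n\ge 3$: $$\begin{aligned} \partial_n(1\otimes Q^n_i\otimes 1)&=1\otimes Q^{n-1}_i\otimes q_i-q_i\otimes P^{n-1}_{i+1}\otimes 1+1\otimes sQ^{n-1}_i\otimes 1,\\ \partial_n(1\otimes P^n_{i+1}\otimes 1)&=1\otimes P^{n-1}_{i+1}\otimes p_{i+1}-p_{i+1}\otimes Q^{n-1}_i\otimes 1+1\otimes sP^{n-1}_{i+1}\otimes 1,\\ \partial_n(1\otimes sP^n_{i+1}\otimes 1)&=1\otimes sP^{n-1}_{i+1}\otimes q_i-s_{i+1}\otimes P^{n-1}_{i+1}\otimes 1+p_{i+1}\otimes sQ^{n-1}_i\otimes 1+1\otimes P^{n-1}_{i+1}\otimes s_{i+1},\\ \partial_n(1\otimes sQ^n_i\otimes 1)&=1\otimes sQ^{n-1}_i\otimes p_{i+1}-s_i\otimes Q^{n-1}_i\otimes 1+q_i\otimes sP^{n-1}_{i+1}\otimes 1+1\otimes Q^{n-1}_i\otimes s_i. \end{aligned}$$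
   Context: Let $\Bbbk$ be a field and $N\ge 1$ an integer (the number $|\mathbf x|$ of punctures). $Q$ is the quiver with vertices $Q_0=\{e_0,\dots,e_N\}$ and arrows $Q_1$: $p_i:e_{i-1}\to e_i$ ($1\le i\le N$), $q_i:e_{i+1}\to e_i$ ($0\le i\le N-1$), and loops $s_i:e_i\to e_i$ ($0\le i\le N$). Paths are composed from right to left. $I$ is the two-sided ideal of the path algebra $\Bbbk Q$ generated by $q_ip_{i+1}-s_i$ ($0\le i\le N-1$), $p_iq_{i-1}-s_i$ ($1\le i\le N$), $s_ip_i-p_is_{i-1}$ ($1\le i\le N$), $s_iq_i-q_is_{i+1}$ ($0\le i\le N-1$), and $A=\Bbbk Q/I$. Ambiguities: $S_0=Q_0$, $S_1=Q_1$, and for $n\ge 2$, $S_n$ is the set of the following $4N$ paths of length $n$ in $Q$, for $0\le i\le N-1$: $P^n_{i+1}=p_{i+1}q_ip_{i+1}q_i\cdots$ and $Q^n_i=q_ip_{i+1}q_ip_{i+1}\cdots$ (alternating, $n$ letters), $sP^n_{i+1}=s_{i+1}p_{i+1}q_ip_{i+1}\cdots$ ($s_{i+1}$ followed to its right by $P^{n-1}_{i+1}$) and $sQ^n_i=s_iq_ip_{i+1}q_i\cdots$ ($s_i$ followed by $Q^{n-1}_i$). In the formulas for $n=2$ one uses the same notation for length $1$: $P^1_{i+1}=p_{i+1}$, $Q^1_i=q_i$, $sP^1_{i+1}=s_{i+1}$, $sQ^1_i=s_i$. $\otimes$ means $\otimes_{\Bbbk Q_0}$, where $\Bbbk Q_0$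 is the semisimple algebra spanned by the vertices; $\Bbbk S_n$ is the $\Bbbk Q_0$-bimodule spanned by $S_n$; $P_n=A\otimes\Bbbk S_n\otimes A$ with the obvious left and right actions, and $P_0=A\otimes_{\Bbbk Q_0}A$. *)

(* Defs.v *)
From HB Require Import structures.
From mathcomp Require Import all_boot all_algebra.
From mathcomp Require Import finmap.
From mathcomp Require Import boolp.
From mathcomp.multinomials Require Import monalg.

Set Implicit Arguments.
Unset Strict Implicit.
Unset Printing Implicit Defensive.

Import GRing.Theory.
Local Open Scope ring_scope.
Local Open Scope quotient_scope.

Section LinearFacts.
Variables (k : pzRingType) (U V : lmodType k) (f : U -> V) (lf : linear f).

Lemma lin0 : f 0 = 0.
Proof. by have := lf (- 1) 0 0; rewrite scaleN1r addNr scaleN1r addNr. Qed.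
Lemma linD x y : f (x + y) = f x + f y.
Proof. by rewrite -[x]scale1r lf !scale1r. Qed.
Lemma linZ c x : f (c *: x) = c *: f x.
Proof. by rewrite -[c *: x]addr0 lf lin0 addr0. Qed.
Lemma linB x y : f (x - y) = f x - f y.
Proof. by rewrite linD -scaleN1r linZ scaleN1r. Qed.
Lemma lin_sum I (r : seq I) (F : I -> U) :
  f (\sum_(i <- r) F i) = \sum_(i <- r) f (F i).
Proof. by elim/big_rec2: _ => [|i u v _ <-]; rewrite ?lin0 ?linD. Qed.
End LinearFacts.

(** The basis vectors of the free module on [K], locked since unification
    diverges on two distinct [<< p >>]. *)
HB.lock Definition mbas (k : comNzRingType) (K : choiceType) (p : K)
  : {malg k[K]} := << p >>.
Arguments mbas {k K} p.

HB.lock Definition linext (k : comNzRingType) (K : choiceType) (V : lmodType k)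
    (f : K -> V) (x : {malg k[K]}) : V :=
  \sum_(p <- msupp x) x@_p *: f p.
Arguments linext {k K V} f x.

Section LinearExtension.
Variables (k : comNzRingType) (K : choiceType) (V : lmodType k).
Implicit Types (f : K -> V).

Lemma linextw (f : K -> V) (d : {fset K}) x :
  fsubset (msupp x) d -> linext f x = \sum_(p <- d) x@_p *: f p.
Proof.
move=> le; rewrite unlock (big_fset_incl _ le) // => p _ np.
by rewrite (mcoeff_outdom np) scale0r.
Qed.

Lemma linext_is_linear f : linear (linext f).
Proof.
move=> c x y; pose d := fsetU (msupp x) (msupp y).
have hx : fsubset (msupp x) d by apply: fsubsetUl.
have hy : fsubset (msupp y) d by apply: fsubsetUr.
have hxy : fsubset (msupp (c *: x + y)) d.
  by rewrite (fsubset_trans (msuppD_le _ _)) // fsetSU // msuppZ_le.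
rewrite (linextw f hx) (linextw f hy) (linextw f hxy) scaler_sumr -big_split.
by apply: eq_bigr => p _; rewrite /= mcoeffD mcoeffZ scalerDl scalerA.
Qed.

HB.instance Definition _ f :=
  GRing.isLinear.Build k {malg k[K]} V _ (linext f) (linext_is_linear f).

Lemma mcoeff_mbas p q : (mbas p : {malg k[K]})@_q = (p == q)%:R.
Proof. by rewrite mbas.unlock mcoeffU. Qed.

Lemma linextU f p : linext f (mbas p) = f p.
Proof. by rewrite mbas.unlock (linextw f msuppU_le) big_seq_fset1 mcoeffUU scale1r. Qed.

Lemma linext0 f : linext f 0 = 0.
Proof. exact: linear0. Qed.
Lemma linextP f c x y : linext f (c *: x + y) = c *: linext f x + linext f y.
Proof. exact: linext_is_linear. Qed.

Lemma malg_ind (P : {malg k[K]} -> Prop) :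
  P 0 -> (forall c p x, P x -> P (c *: mbas p + x)) -> forall x, P x.
Proof.
move=> P0 PS x; rewrite [x]monalgE.
elim: (enum_fset (msupp x)) => [|p s IH]; first by rewrite big_nil.
rewrite big_cons.
suff -> : << x@_p *g p >> = x@_p *: mbas p by apply: PS.
rewrite mbas.unlock.
by apply/malgP => q; rewrite mcoeffZ !mcoeffU mulrnAr mulr1.
Qed.

Lemma linext_eq (f g : {malg k[K]} -> V) :
  linear f -> linear g -> (forall p, f (mbas p) = g (mbas p)) -> f =1 g.
Proof.
move=> lf lg fg; elim/malg_ind => [|c p x IH]; first by rewrite !lin0.
by rewrite lf lg fg IH.
Qed.

End LinearExtension.

Section Span.
Variables (k : comNzRingType) (V : lmodType k).

Inductive span (G : V -> Prop) : V -> Prop :=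
| span0 : span G 0
| spanS c x y of G x & span G y : span G (c *: x + y).

Definition span_pred (G : V -> Prop) (x : V) : bool := `[< span G x >].

Lemma span_gen (G : V -> Prop) x : G x -> span G x.
Proof.
by move=> Gx; rewrite -[x]addr0 -[x]scale1r; apply: spanS => //; apply: span0.
Qed.

Lemma spanD (G : V -> Prop) x y : span G x -> span G y -> span G (x + y).
Proof.
elim=> [|c u v Gu _ IH] Sy; first by rewrite add0r.
by rewrite -addrA; apply: spanS => //; apply: IH.
Qed.

Lemma spanZ (G : V -> Prop) c x : span G x -> span G (c *: x).
Proof.
elim=> [|d u v Gu _ IH]; first by rewrite scaler0; apply: span0.
by rewrite scalerDr scalerA; apply: spanS.
Qed.

Lemma span_zmod_closed G : zmod_closed (span_pred G).
Proof.
split=> [|x y /asboolP Sx /asboolP Sy]; first exact/asboolP/span0.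
by apply/asboolP; apply: spanD => //; rewrite -scaleN1r; apply: spanZ.
Qed.

HB.instance Definition _ G :=
  GRing.isZmodClosed.Build V (span_pred G) (span_zmod_closed G).

Definition span_closed G := GRing.ZmodClosed.clone V (span_pred G) _.

Definition quo (G : V -> Prop) : Type := @Quotient.quot V (span_closed G).

HB.instance Definition _ G := GRing.Zmodule.on (quo G).
HB.instance Definition _ G := EqQuotient.on (quo G).

Variable G : V -> Prop.
Definition qpi (x : V) : quo G := \pi_(quo G) x.

Lemma qpi_eq x y : qpi x = qpi y <-> span G (x - y).
Proof.
split=> [/eqP|S]; first by rewrite /qpi /quo -Quotient.idealrBE => /asboolP.
by apply/eqP; rewrite /qpi /quo -Quotient.idealrBE; apply/asboolP.
Qed.

Lemma qpiD x y : qpi (x + y) = qpi x + qpi y.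
Proof. exact: (@Quotient.pi_add V (span_closed G)). Qed.

Lemma qpi0 : qpi 0 = 0.
Proof. by apply: (addrI (qpi 0)); rewrite -qpiD !addr0. Qed.

Lemma qpi_eq0 x : qpi x = 0 <-> span G x.
Proof. by rewrite -qpi0 qpi_eq subr0. Qed.

Lemma qpiK (x : quo G) : qpi (repr x) = x.
Proof. exact: reprK. Qed.

(** The map induced on the quotient by [f]; meaningful for [f] linear and
    vanishing on [G]. *)
Definition quolift (W : lmodType k) (f : V -> W) (x : quo G) : W := f (repr x).

Lemma quoliftE (W : lmodType k) (f : {linear V -> W}) :
  (forall x, G x -> f x = 0) -> forall x, quolift f (qpi x) = f x.
Proof.
move=> f0 x; apply/eqP; rewrite -subr_eq0 /quolift -linearB; apply/eqP.
have: span G (repr (qpi x) - x) by apply/qpi_eq; rewrite qpiK.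
elim=> [|c u v Gu _ IH]; first by rewrite linear0.
by rewrite linearP f0 // scaler0 add0r.
Qed.

Definition quoscale (c : k) (x : quo G) : quo G := qpi (c *: repr x).

Lemma quoscaleE c x : quoscale c (qpi x) = qpi (c *: x).
Proof.
by apply/qpi_eq; rewrite -scalerBr; apply/spanZ/qpi_eq; rewrite qpiK.
Qed.

Fact quoscaleA c d x : quoscale c (quoscale d x) = quoscale (c * d) x.
Proof. by rewrite -[x]qpiK !quoscaleE scalerA. Qed.
Fact quoscale1 : left_id 1 quoscale.
Proof. by move=> x; rewrite -[x]qpiK !quoscaleE scale1r. Qed.
Fact quoscaleDr : right_distributive quoscale +%R.
Proof.
by move=> c x y; rewrite -[x]qpiK -[y]qpiK -qpiD !quoscaleE -qpiD scalerDr.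
Qed.
Fact quoscaleDl x : {morph quoscale^~ x : c d / c + d}.
Proof. by move=> c d; rewrite -[x]qpiK !quoscaleE -qpiD scalerDl. Qed.

HB.instance Definition _ := GRing.Zmodule_isLmodule.Build k (quo G)
  quoscaleA quoscale1 quoscaleDr quoscaleDl.

Lemma qpi_is_linear : linear qpi.
Proof. by move=> c x y; rewrite qpiD -quoscaleE. Qed.

HB.instance Definition _ :=
  GRing.isLinear.Build k V (quo G) _ qpi qpi_is_linear.

End Span.

Section QuotientAlgebra.
Variables (k : comNzRingType) (R : algType k) (G : R -> Prop).

Definition ideal_gens (x : R) : Prop := exists a g b, G g /\ x = a * g * b.
Definition ideal : R -> Prop := span ideal_gens.

Lemma idealMl a x : ideal x -> ideal (a * x).
Proof.
elim=> [|c _ y [b [g [d [Gg ->]]]] _ IH]; first by rewrite mulr0; apply: span0.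
rewrite mulrDr -scalerAr; apply: spanS => //.
by exists (a * b), g, d; rewrite !mulrA.
Qed.

Lemma idealMr a x : ideal x -> ideal (x * a).
Proof.
elim=> [|c _ y [b [g [d [Gg ->]]]] _ IH]; first by rewrite mul0r; apply: span0.
rewrite mulrDl -scalerAl; apply: spanS => //.
by exists b, g, (d * a); rewrite !mulrA.
Qed.

(** [algType] requires [1 != 0], hence the properness argument. *)
Definition quoalg (proper : ~ ideal 1) : Type := quo ideal_gens.

Variable proper : ~ ideal 1.
Local Notation A := (quoalg proper).
HB.instance Definition _ := GRing.Lmodule.on A.

Definition qalg (x : R) : A := qpi ideal_gens x.
Definition quomul (x y : A) : A := qalg (repr (x : quo _) * repr (y : quo _)).

Lemma qalgK (x : A) : qalg (repr (x : quo _)) = x.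
Proof. exact: qpiK. Qed.

Lemma quomulE x y : quomul (qalg x) (qalg y) = qalg (x * y).
Proof.
apply/qpi_eq; set x' := repr _; set y' := repr _.
have -> : x' * y' - x * y = (x' - x) * y' + x * (y' - y).
  by rewrite mulrBl mulrBr addrA subrK.
by apply: spanD; [apply: idealMr | apply: idealMl]; apply/qpi_eq; rewrite qpiK.
Qed.

Lemma qalgD x y : qalg (x + y) = qalg x + qalg y. Proof. exact: qpiD. Qed.
Lemma qalgZ c x : qalg (c *: x) = c *: qalg x. Proof. exact: linearZ. Qed.

Fact quomulA : associative quomul.
Proof.
by move=> x y z; rewrite -[x]qalgK -[y]qalgK -[z]qalgK !quomulE mulrA.
Qed.
Fact quomul1 : left_id (qalg 1) quomul.
Proof. by move=> x; rewrite -[x]qalgK quomulE mul1r. Qed.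
Fact quo1mul : right_id (qalg 1) quomul.
Proof. by move=> x; rewrite -[x]qalgK quomulE mulr1. Qed.
Fact quomulDl : left_distributive quomul +%R.
Proof.
move=> x y z; rewrite -[x]qalgK -[y]qalgK -[z]qalgK -qalgD !quomulE -qalgD.
by rewrite mulrDl.
Qed.
Fact quomulDr : right_distributive quomul +%R.
Proof.
move=> x y z; rewrite -[x]qalgK -[y]qalgK -[z]qalgK -qalgD !quomulE -qalgD.
by rewrite mulrDr.
Qed.
Fact quo1_neq0 : qalg 1 != 0.
Proof. by apply/eqP => /qpi_eq0. Qed.

HB.instance Definition _ := GRing.Zmodule_isNzRing.Build A
  quomulA quomul1 quo1mul quomulDl quomulDr quo1_neq0.

Lemma qalgM x y : qalg (x * y) = qalg x * qalg y.
Proof. by rewrite -quomulE. Qed.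

Fact quoscaleAl (c : k) (x y : A) : c *: (x * y) = (c *: x) * y.
Proof.
by rewrite -[x]qalgK -[y]qalgK -qalgM -!qalgZ -qalgM scalerAl.
Qed.
Fact quoscaleAr (c : k) (x y : A) : c *: (x * y) = x * (c *: y).
Proof.
by rewrite -[x]qalgK -[y]qalgK -qalgM -!qalgZ -qalgM scalerAr.
Qed.

HB.instance Definition _ := GRing.Lmodule_isLalgebra.Build k A quoscaleAl.
HB.instance Definition _ := GRing.Lalgebra_isAlgebra.Build k A quoscaleAr.

Fact qalg_linear : linear qalg. Proof. by move=> c x y; rewrite qalgD qalgZ. Qed.
Fact qalg_monoid : monoid_morphism qalg. Proof. by split=> // x y; exact: qalgM. Qed.
HB.instance Definition _ := GRing.isLinear.Build k R A _ qalg qalg_linear.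
HB.instance Definition _ := GRing.isMonoidMorphism.Build R A qalg qalg_monoid.

End QuotientAlgebra.

(** [vert0] witnesses that there is a vertex, so that the path algebra has
    [1 != 0], as [algType] requires. *)
Record quiver := Quiver {
  vert : finType;
  arr : choiceType;
  src : arr -> vert;
  tgt : arr -> vert;
  vert0 : vert
}.

Section Paths.
Variable Q : quiver.

(** A path is a pair of its target and its arrows, listed as in right-to-left
    composition: [(t, [:: a_n; ...; a_1])] is the path [a_n ... a_1] ending
    at [t], and [(v, [::])] is the trivial path at [v]. *)
Fixpoint wf_path (t : vert Q) (s : seq (arr Q)) : bool :=
  if s is a :: s' then (tgt a == t) && wf_path (src a) s' else true.

Definition qpath : Type := {x : vert Q * seq (arr Q) | wf_path x.1 x.2}.
HB.instance Definition _ := SubChoice.on qpath.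

Definition ptgt (p : qpath) : vert Q := (val p).1.
Definition parr (p : qpath) : seq (arr Q) := (val p).2.
Definition psrc (p : qpath) : vert Q := last (ptgt p) (map (@src Q) (parr p)).

Definition ptriv (v : vert Q) : qpath := Sub (v, [::]) isT.

Lemma arrow_wf (a : arr Q) : wf_path (tgt a) [:: a].
Proof. by rewrite /= eqxx. Qed.
Definition parrow (a : arr Q) : qpath :=
  Sub (tgt a, [:: a]) (arrow_wf a).

(** [pcomp p q] is the path [p q] ([q] first) when the paths compose. *)
Definition pcomp (p q : qpath) : option qpath :=
  if psrc p == ptgt q then (insub (ptgt p, parr p ++ parr q) : option qpath)
  else None.

Lemma wf_cat t s1 s2 :
  wf_path t (s1 ++ s2) = wf_path t s1 && wf_path (last t (map (@src Q) s1)) s2.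
Proof. by elim: s1 t => [|a s IH] t //=; rewrite IH andbA. Qed.

Lemma pcompE p q : psrc p = ptgt q ->
  exists r, [/\ pcomp p q = Some r, ptgt r = ptgt p, psrc r = psrc q
              & parr r = parr p ++ parr q].
Proof.
move=> e; have w : wf_path (ptgt p) (parr p ++ parr q).
  by rewrite wf_cat (valP p) /= -/(psrc p) e (valP q).
exists (Sub (ptgt p, parr p ++ parr q) w); split=> //.
  by rewrite /pcomp e eqxx insubT.
by rewrite /psrc /ptgt /parr /= map_cat last_cat -/(ptgt p) -/(psrc p) e.
Qed.

Lemma qpathP (p q : qpath) : ptgt p = ptgt q -> parr p = parr q -> p = q.
Proof.
move=> e1 e2; apply: val_inj; move: e1 e2; rewrite /ptgt /parr.
by case: (val p) (val q) => [? ?] [? ?] /= -> ->.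
Qed.

Lemma pcompA p q r :
  obind (pcomp p) (pcomp q r) = obind (fun u => pcomp u r) (pcomp p q).
Proof.
case: (eqVneq (psrc p) (ptgt q)) => [epq|npq]; last first.
  have -> : pcomp p q = None by rewrite /pcomp (negPf npq).
  case: (eqVneq (psrc q) (ptgt r)) => [/pcompE [u [-> tu _ _]]|nqr] /=.
    by rewrite /pcomp tu (negPf npq).
  by rewrite /pcomp (negPf nqr).
have [u [-> tu su au]] := pcompE epq; rewrite /=.
case: (eqVneq (psrc q) (ptgt r)) => [eqr|nqr]; last first.
  by rewrite /pcomp su (negPf nqr).
have [v [-> tv sv av]] := pcompE eqr; rewrite /=.
have [|w [-> tw _ aw]] := @pcompE p v; first by rewrite tv.
have [|x [-> tx _ ax]] := @pcompE u r; first by rewrite su.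
congr Some; apply: qpathP; first by rewrite tw tx tu.
by rewrite aw ax av au catA.
Qed.

Lemma pcomp1l v p : pcomp (ptriv v) p = if v == ptgt p then Some p else None.
Proof.
rewrite {1}/pcomp /=; have -> : psrc (ptriv v) = v by [].
case: eqP => // ->; rewrite /ptgt /parr /= -surjective_pairing.
by rewrite valK.
Qed.

Lemma pcomp1r v p : pcomp p (ptriv v) = if psrc p == v then Some p else None.
Proof.
rewrite {1}/pcomp; have -> : ptgt (ptriv v) = v by [].
by case: eqP => // _; rewrite cats0 -surjective_pairing valK.
Qed.

End Paths.

Section PathAlgebra.
Variables (k : comNzRingType) (Q : quiver).

Definition pathalg : Type := {malg k[qpath Q]}.
HB.instance Definition _ := GRing.Lmodule.on pathalg.

Definition pelt (p : qpath Q) : pathalg := mbas p.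

Definition pmul2 (p q : qpath Q) : pathalg := oapp pelt 0 (pcomp p q).
Definition pmul (x y : pathalg) : pathalg :=
  linext (fun p => linext (pmul2 p) y) x.
Definition pone : pathalg := \sum_(v : vert Q) pelt (ptriv v).

Lemma pmul0x y : pmul 0 y = 0.
Proof. exact: linext0. Qed.
Lemma pmulUx p y : pmul (mbas p) y = linext (pmul2 p) y.
Proof. exact: linextU. Qed.
Fact pmulPl y : linear (pmul^~ y).
Proof. by move=> c x z; rewrite /pmul linextP. Qed.
Fact pmulPr x : linear (pmul x).
Proof.
move=> c y z; elim/malg_ind: x => [|d p x IH].
  by rewrite !pmul0x scaler0 addr0.
rewrite !pmulPl IH !pmulUx linextP !scalerDr !scalerA [d * c]mulrC.
exact: addrACA.
Qed.

Lemma pmulU p q : pmul (pelt p) (pelt q) = pmul2 p q.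
Proof. by rewrite /pmul !linextU. Qed.

Fact pmulA : associative pmul.
Proof.
move=> x y z.
apply: (linext_eq (f := fun x => pmul x (pmul y z))
                  (g := fun x => pmul (pmul x y) z)).
- by move=> c u v; rewrite pmulPl.
- by move=> c u v; rewrite !pmulPl.
move=> p; apply: (linext_eq (f := fun y => pmul (mbas p) (pmul y z))
                            (g := fun y => pmul (pmul (mbas p) y) z)).
- by move=> c u v; rewrite pmulPl pmulPr.
- by move=> c u v; rewrite pmulPr pmulPl.
move=> q; apply: (linext_eq (f := fun z => pmul (mbas p) (pmul (mbas q) z))
                            (g := fun z => pmul (pmul (mbas p) (mbas q)) z)).
- by move=> c u v; rewrite !pmulPr.
- by move=> c u v; rewrite !pmulPr.
move=> r; rewrite -!/(pelt _) !pmulU /pmul2.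
have -> (o : option (qpath Q)) :
    pmul (pelt p) (oapp pelt 0 o) = oapp pelt 0 (obind (pcomp p) o).
  by case: o => [u|] /=; rewrite ?pmulU // (lin0 (pmulPr _)).
have -> (o : option (qpath Q)) :
    pmul (oapp pelt 0 o) (pelt r) = oapp pelt 0 (obind (fun u => pcomp u r) o).
  by case: o => [u|] /=; rewrite ?pmulU // pmul0x.
by rewrite pcompA.
Qed.

Fact pmul1l : left_id pone pmul.
Proof.
move=> x; rewrite /pone.
have -> : pmul (\sum_v pelt (ptriv v)) x = \sum_v pmul (pelt (ptriv v)) x.
  exact: (lin_sum (pmulPl x)).
apply: (linext_eq (f := fun x => \sum_v pmul (pelt (ptriv v)) x) (g := id)) => //.
  move=> c u v; rewrite scaler_sumr -big_split; apply: eq_bigr => w _.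
  exact: pmulPr.
move=> p; rewrite -/(pelt p) (bigD1 (ptgt p)) //= big1 ?addr0 => [|v nv];
  by rewrite pmulU /pmul2 pcomp1l ?eqxx ?(negPf nv).
Qed.

Fact pmul1r : right_id pone pmul.
Proof.
move=> x; rewrite /pone (lin_sum (pmulPr x)).
apply: (linext_eq (f := fun x => \sum_v pmul x (pelt (ptriv v))) (g := id)) => //.
  move=> c u v; rewrite scaler_sumr -big_split; apply: eq_bigr => w _.
  exact: pmulPl.
move=> p; rewrite -/(pelt p) (bigD1 (psrc p)) //= big1 ?addr0 => [|v nv].
  by rewrite pmulU /pmul2 pcomp1r eqxx.
by rewrite pmulU /pmul2 pcomp1r eq_sym (negPf nv).
Qed.

Lemma pone_triv v : mcoeff (ptriv v) pone = 1.
Proof.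
rewrite /pone raddf_sum (bigD1 v) //= big1 => [|w nw].
  by rewrite addr0 mcoeff_mbas eqxx.
rewrite mcoeff_mbas; case: eqP => // /(congr1 (@ptgt Q)).
by rewrite /ptgt /= => e; rewrite e eqxx in nw.
Qed.

Fact pone_neq0 : pone != 0.
Proof.
apply/eqP => /(congr1 (mcoeff (ptriv (vert0 Q)))).
by rewrite pone_triv mcoeff0 => /eqP; rewrite oner_eq0.
Qed.

HB.instance Definition _ := GRing.Zmodule_isNzRing.Build pathalg
  pmulA pmul1l pmul1r (fun x y z => linD (pmulPl z) x y)
  (fun x => linD (pmulPr x)) pone_neq0.

Fact pscaleAl (c : k) (x y : pathalg) : c *: (x * y) = (c *: x) * y.
Proof. by rewrite -(linZ (pmulPl y)). Qed.
Fact pscaleAr (c : k) (x y : pathalg) : c *: (x * y) = x * (c *: y).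
Proof. by rewrite -(linZ (pmulPr x)). Qed.
HB.instance Definition _ := GRing.Lmodule_isLalgebra.Build k pathalg pscaleAl.
HB.instance Definition _ := GRing.Lalgebra_isAlgebra.Build k pathalg pscaleAr.

Lemma peltM p q : pelt p * pelt q = oapp pelt 0 (pcomp p q).
Proof. exact: pmulU. Qed.

Lemma pelt1 : 1 = \sum_(v : vert Q) pelt (ptriv v) :> pathalg.
Proof. by []. Qed.

End PathAlgebra.

(** The algebra [k Q_0], realised as the functions on the vertices: [c] is
    [\sum_v c v *: e_v], and the product is pointwise. *)
Section VertexAlgebra.
Variables (k : comNzRingType) (Q : quiver).

Definition vertalg : Type := {ffun vert Q -> k^o}.
HB.instance Definition _ := GRing.PzRing.on vertalg.
HB.instance Definition _ := GRing.Lmodule.on vertalg.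
Fact vertalg1_neq0 : 1 != 0 :> vertalg.
Proof.
apply/eqP => /ffunP /(_ (vert0 Q)) /eqP.
by rewrite !ffunE oner_eq0.
Qed.
HB.instance Definition _ :=
  GRing.PzSemiRing_isNonZero.Build vertalg vertalg1_neq0.
Fact vertscaleAl (c : k) (x y : vertalg) : c *: (x * y) = (c *: x) * y.
Proof. by apply/ffunP => v; rewrite !ffunE scalerAl. Qed.
Fact vertscaleAr (c : k) (x y : vertalg) : c *: (x * y) = x * (c *: y).
Proof. by apply/ffunP => v; rewrite !ffunE scalerAr. Qed.
HB.instance Definition _ := GRing.Lmodule_isLalgebra.Build k vertalg vertscaleAl.
HB.instance Definition _ := GRing.Lalgebra_isAlgebra.Build k vertalg vertscaleAr.

Definition vertincl (c : vertalg) : pathalg k Q :=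
  \sum_(v : vert Q) c v *: pelt k (ptriv v).

Fact vertincl_linear : linear vertincl.
Proof.
move=> a c d; rewrite /vertincl scaler_sumr -big_split; apply: eq_bigr => v _.
by rewrite !ffunE scalerDl scalerA.
Qed.
Fact vertincl_monoid : monoid_morphism vertincl.
Proof.
split=> [|c d]; rewrite /vertincl.
  by rewrite pelt1; apply: eq_bigr => v _; rewrite ffunE scale1r.
rewrite mulr_suml; apply: eq_bigr => v _; rewrite mulr_sumr (bigD1 v) //=.
rewrite big1 => [|w nw]; rewrite -scalerAl -scalerAr peltM pcomp1l.
  by rewrite eqxx /= addr0 scalerA ffunE.
by rewrite eq_sym (negPf nw) !scaler0.
Qed.
HB.instance Definition _ :=
  GRing.isLinear.Build k vertalg (pathalg k Q) _ vertincl vertincl_linear.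
HB.instance Definition _ :=
  GRing.isMonoidMorphism.Build vertalg (pathalg k Q) vertincl vertincl_monoid.
End VertexAlgebra.

(** [k] acts centrally: both actions are [k]-bilinear. *)
Record bimod_axioms (k : comNzRingType) (R S : algType k) (M : lmodType k)
    (la : R -> M -> M) (ra : M -> S -> M) : Prop := BimodAxioms {
  lact_linear_l : forall m, linear (la^~ m);
  lact_linear_r : forall a, linear (la a);
  lact_one : forall m, la 1 m = m;
  lact_mul : forall a b m, la (a * b) m = la a (la b m);
  ract_linear_l : forall b, linear (ra^~ b);
  ract_linear_r : forall m, linear (ra m);
  ract_one : forall m, ra m 1 = m;
  ract_mul : forall a b m, ra m (a * b) = ra (ra m a) b;
  lract_assoc : forall a m b, la a (ra m b) = ra (la a m) b
}.

Record bimod (k : comNzRingType) (R S : algType k) := Bimod {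
  bcar :> lmodType k;
  lact : R -> bcar -> bcar;
  ract : bcar -> S -> bcar;
  bimodP : bimod_axioms lact ract
}.

Section BimodMaps.
Variables (k : comNzRingType) (R S : algType k).

Definition bimod_hom (M N : bimod R S) (f : M -> N) : Prop :=
  [/\ linear f, forall a x, f (lact a x) = lact a (f x)
    & forall x b, f (ract x b) = ract (f x) b].

Definition projective_bimod (P : bimod R S) : Prop :=
  forall (X Y : bimod R S) (g : X -> Y) (f : P -> Y),
    bimod_hom g -> (forall y, exists x, g x = y) -> bimod_hom f ->
    exists h : P -> X, bimod_hom h /\ forall p, g (h p) = f p.

(** [... -> P 2 -> P 1 -> P 0 -> M -> 0], with [d n : P n.+1 -> P n]. *)
Definition projective_resolution (M : bimod R S) (P : nat -> bimod R S)
    (eps : P 0%N -> M) (d : forall n, P n.+1 -> P n) : Prop :=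
  [/\ bimod_hom eps /\ forall n, bimod_hom (d n),
      forall n, projective_bimod (P n),
      forall y, exists x, eps x = y,
      forall x, eps x = 0 <-> exists y, d 0%N y = x
    & forall n x, d n x = 0 <-> exists y, d n.+1 y = x].

End BimodMaps.

Section RegularBimodule.
Variables (k : comNzRingType) (R S A : algType k).
Variables (phi : {lrmorphism R -> A}) (psi : {lrmorphism S -> A}).

Fact regbimodP :
  bimod_axioms (fun r (x : A) => phi r * x) (fun (x : A) s => x * psi s).
Proof.
split=> [m c x y|a c x y|m|a b m|b c x y|m c x y|m|a b m|a m b].
- by rewrite linearP mulrDl scalerAl.
- by rewrite mulrDr scalerAr.
- by rewrite rmorph1 mul1r.
- by rewrite rmorphM mulrA.
- by rewrite mulrDl scalerAl.
- by rewrite linearP mulrDr scalerAr.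
- by rewrite rmorph1 mulr1.
- by rewrite rmorphM mulrA.
- by rewrite mulrA.
Qed.
Definition regbimod : bimod R S := Bimod regbimodP.
End RegularBimodule.

Definition diagbimod (k : comNzRingType) (A : algType k) : bimod A A :=
  @regbimod k A A A idfun idfun.

Section Tensor.
Variables (k : comNzRingType) (R S T : algType k).
Variables (M : bimod R S) (N : bimod S T).
Local Notation F := {malg k[(M * N)%type]}.

Inductive tensor_rel : F -> Prop :=
| tensor_addl m m' n :
    tensor_rel (mbas (m + m', n) - (mbas (m, n) + mbas (m', n)))
| tensor_addr m n n' :
    tensor_rel (mbas (m, n + n') - (mbas (m, n) + mbas (m, n')))
| tensor_scalel c m n : tensor_rel (mbas (c *: m, n) - c *: mbas (m, n))
| tensor_scaler c m n : tensor_rel (mbas (m, c *: n) - c *: mbas (m, n))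
| tensor_bal m s n : tensor_rel (mbas (ract m s, n) - mbas (m, lact s n)).

Definition tensor_car : lmodType k := quo tensor_rel.
Definition tens (m : M) (n : N) : tensor_car := qpi tensor_rel (mbas (m, n)).

Definition tensor_lact (a : R) : tensor_car -> tensor_car :=
  quolift (linext (fun p : M * N => tens (lact a p.1) p.2)).
Definition tensor_ract (x : tensor_car) (b : T) : tensor_car :=
  quolift (linext (fun p : M * N => tens p.1 (ract p.2 b))) x.

Lemma tensDl m m' n : tens (m + m') n = tens m n + tens m' n.
Proof.
by rewrite /tens -qpiD; apply/qpi_eq/span_gen; apply: tensor_addl.
Qed.
Lemma tensDr m n n' : tens m (n + n') = tens m n + tens m n'.
Proof.
by rewrite /tens -qpiD; apply/qpi_eq/span_gen; apply: tensor_addr.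
Qed.
Lemma tensZl c m n : tens (c *: m) n = c *: tens m n.
Proof.
by rewrite /tens -linearZ; apply/qpi_eq/span_gen; apply: tensor_scalel.
Qed.
Lemma tensZr c m n : tens m (c *: n) = c *: tens m n.
Proof.
by rewrite /tens -linearZ; apply/qpi_eq/span_gen; apply: tensor_scaler.
Qed.
Lemma tens_bal m s n : tens (ract m s) n = tens m (lact s n).
Proof. by apply/qpi_eq/span_gen; apply: tensor_bal. Qed.

Lemma tens_ind (P : tensor_car -> Prop) :
  P 0 -> (forall m n x, P x -> P (tens m n + x)) -> forall x, P x.
Proof.
move=> P0 PS x; rewrite -[x]qpiK; elim/malg_ind: (repr x) => [|c [m n] y IH].
  by rewrite qpi0.
have -> : qpi tensor_rel (c *: mbas (m, n) + y) =
    tens (c *: m) n + qpi tensor_rel y by rewrite tensZl; apply: qpi_is_linear.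
exact: PS.
Qed.

Lemma tensor_lift_tens (W : lmodType k) (f : M * N -> W) :
  (forall m m' n, f (m + m', n) = f (m, n) + f (m', n)) ->
  (forall m n n', f (m, n + n') = f (m, n) + f (m, n')) ->
  (forall c m n, f (c *: m, n) = c *: f (m, n)) ->
  (forall c m n, f (m, c *: n) = c *: f (m, n)) ->
  (forall m s n, f (ract m s, n) = f (m, lact s n)) ->
  forall m n, quolift (linext f) (tens m n) = f (m, n).
Proof.
move=> fDl fDr fZl fZr fB m n; rewrite /tens quoliftE; first exact: linextU.
have lf := linext_is_linear f.
by move=> _ [] *; rewrite /= (linB lf) ?(linD lf) ?(linZ lf) !linextU
  ?(fDl, fDr, fZl, fZr, fB) subrr.
Qed.

Lemma quolift_linear (W : lmodType k) (f : {linear F -> W}) :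
  (forall x, tensor_rel x -> f x = 0) ->
  linear (quolift f : tensor_car -> W).
Proof.
move=> f0 c x y; rewrite -[x]qpiK -[y]qpiK -[c *: _ + _]linearP.
by rewrite !quoliftE // linearP.
Qed.

Lemma tensor_lift_linear (W : lmodType k) (f : M * N -> W) :
  (forall m m' n, f (m + m', n) = f (m, n) + f (m', n)) ->
  (forall m n n', f (m, n + n') = f (m, n) + f (m, n')) ->
  (forall c m n, f (c *: m, n) = c *: f (m, n)) ->
  (forall c m n, f (m, c *: n) = c *: f (m, n)) ->
  (forall m s n, f (ract m s, n) = f (m, lact s n)) ->
  linear (quolift (linext f) : tensor_car -> W).
Proof.
move=> fDl fDr fZl fZr fB; apply: quolift_linear.
have lf := linext_is_linear f.
by move=> _ [] *; rewrite /= (linB lf) ?(linD lf) ?(linZ lf) !linextU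
  ?(fDl, fDr, fZl, fZr, fB) subrr.
Qed.

Lemma tensor_lact_tens a m n : tensor_lact a (tens m n) = tens (lact a m) n.
Proof.
have A := bimodP M; apply: (tensor_lift_tens (f := fun p => tens _ _)) => * /=.
- by rewrite (linD (lact_linear_r A a)) tensDl.
- by rewrite tensDr.
- by rewrite (linZ (lact_linear_r A a)) tensZl.
- by rewrite tensZr.
- by rewrite (lract_assoc A) tens_bal.
Qed.

Lemma tensor_ract_tens m n b : tensor_ract (tens m n) b = tens m (ract n b).
Proof.
have A := bimodP N; apply: (tensor_lift_tens (f := fun p => tens _ _)) => * /=.
- by rewrite tensDl.
- by rewrite (linD (ract_linear_l A b)) tensDr.
- by rewrite tensZl.
- by rewrite (linZ (ract_linear_l A b)) tensZr.
- by rewrite tens_bal (lract_assoc A).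
Qed.

Lemma tensor_lact_linear a : linear (tensor_lact a).
Proof.
have A := bimodP M; apply: tensor_lift_linear => * /=.
- by rewrite (linD (lact_linear_r A a)) tensDl.
- by rewrite tensDr.
- by rewrite (linZ (lact_linear_r A a)) tensZl.
- by rewrite tensZr.
- by rewrite (lract_assoc A) tens_bal.
Qed.

Lemma tensor_ract_linear b : linear (tensor_ract^~ b).
Proof.
have A := bimodP N.
apply: (tensor_lift_linear (f := fun p => tens p.1 (ract p.2 b))) => * /=.
- by rewrite tensDl.
- by rewrite (linD (ract_linear_l A b)) tensDr.
- by rewrite tensZl.
- by rewrite (linZ (ract_linear_l A b)) tensZr.
- by rewrite tens_bal (lract_assoc A).
Qed.

Fact tensor_bimodP : bimod_axioms tensor_lact tensor_ract.
Proof.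
have A := bimodP M; have B := bimodP N.
have lD a := linD (tensor_lact_linear a).
have l0 a := lin0 (tensor_lact_linear a).
have rD b := linD (tensor_ract_linear b).
have r0 b := lin0 (tensor_ract_linear b).
split.
- move=> x c a b; elim/tens_ind: x => [|m n x IH].
    by rewrite !l0 scaler0 addr0.
  rewrite !lD IH !tensor_lact_tens (lact_linear_l A) tensDl tensZl.
  by rewrite scalerDr addrACA.
- exact: tensor_lact_linear.
- elim/tens_ind=> [|m n x IH]; first by rewrite l0.
  by rewrite lD IH tensor_lact_tens (lact_one A).
- move=> a b; elim/tens_ind=> [|m n x IH]; first by rewrite !l0.
  by rewrite !lD IH !tensor_lact_tens (lact_mul A).
- exact: tensor_ract_linear.
- move=> x c a b; elim/tens_ind: x => [|m n x IH].
    by rewrite !r0 scaler0 addr0.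
  rewrite !rD IH !tensor_ract_tens (ract_linear_r B) tensDr tensZr.
  by rewrite scalerDr addrACA.
- elim/tens_ind=> [|m n x IH]; first by rewrite r0.
  by rewrite rD IH tensor_ract_tens (ract_one B).
- move=> a b; elim/tens_ind=> [|m n x IH]; first by rewrite !r0.
  by rewrite !rD IH !tensor_ract_tens (ract_mul B).
- move=> a x b; elim/tens_ind: x => [|m n x IH]; first by rewrite !(l0, r0).
  by rewrite !(lD, rD) IH !(tensor_lact_tens, tensor_ract_tens).
Qed.

Definition tensor : bimod R T := Bimod tensor_bimodP.

End Tensor.

(** For [i : 'I_N], [Ap i] is [p_(i+1) : e_i -> e_(i+1)] and [Aq i] is
    [q_i : e_(i+1) -> e_i]; [As j] is the loop [s_j]. *)
Variant arrow (N : nat) := Ap of 'I_N | Aq of 'I_N | As of 'I_N.+1.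

Section ArrowFinite.
Variable N : nat.
Definition arrow_code (a : arrow N) : 'I_N + 'I_N + 'I_N.+1 :=
  match a with Ap i => inl (inl i) | Aq i => inl (inr i) | As j => inr j end.
Definition arrow_decode (x : 'I_N + 'I_N + 'I_N.+1) : arrow N :=
  match x with inl (inl i) => Ap i | inl (inr i) => Aq i | inr j => As j end.
Lemma arrow_codeK : cancel arrow_code arrow_decode. Proof. by case. Qed.
HB.instance Definition _ := Finite.copy (arrow N) (can_type arrow_codeK).
End ArrowFinite.

Section TheAlgebra.
Variables (k : fieldType) (N : nat).

(** The vertices [e_i] and [e_(i+1)]. *)
Definition lo (i : 'I_N) : 'I_N.+1 := widen_ord (leqnSn N) i.
Definition hi (i : 'I_N) : 'I_N.+1 := lift ord0 i.

Definition asrc (a : arrow N) : 'I_N.+1 :=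
  match a with Ap i => lo i | Aq i => hi i | As j => j end.
Definition atgt (a : arrow N) : 'I_N.+1 :=
  match a with Ap i => hi i | Aq i => lo i | As j => j end.

Definition Qx : quiver :=
  {| vert := 'I_N.+1; arr := arrow N; src := asrc; tgt := atgt; vert0 := ord0 |}.

Definition kQ : algType k := pathalg k Qx.
Definition kQ0 : algType k := vertalg k Qx.
Definition arrelt (a : arrow N) : kQ := pelt k (parrow (a : arr Qx)).

Inductive rels : kQ -> Prop :=
| rel_qp i : rels (arrelt (Aq i) * arrelt (Ap i) - arrelt (As (lo i)))
| rel_pq i : rels (arrelt (Ap i) * arrelt (Aq i) - arrelt (As (hi i)))
| rel_sp i : rels (arrelt (As (hi i)) * arrelt (Ap i)
                   - arrelt (Ap i) * arrelt (As (lo i)))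
| rel_sq i : rels (arrelt (As (lo i)) * arrelt (Aq i)
                   - arrelt (Aq i) * arrelt (As (hi i))).

Lemma coef_triv_mul v (x y : kQ) :
  (x * y)@_(ptriv v) = x@_(ptriv v) * y@_(ptriv v).
Proof.
pose c (z : kQ) : k^o := z@_(ptriv v).
have cP : linear c by move=> a u w; rewrite /c mcoeffD mcoeffZ.
rewrite -!/(c _).
apply: (linext_eq (f := fun x : kQ => c (x * y)) (g := fun x : kQ => c x * c y)).
- by move=> a u w; rewrite mulrDl -scalerAl cP.
- by move=> a u w; rewrite cP mulrDl scalerAl.
move=> p; rewrite -/(pelt k p).
apply: (linext_eq (f := fun y : kQ => c ((pelt k p : kQ) * y))
                  (g := fun y : kQ => c (pelt k p) * c y)).
- by move=> a u w; rewrite mulrDr -scalerAr cP.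
- by move=> a u w; rewrite cP mulrDr scalerAr.
move=> q; rewrite -/(pelt k q) peltM.
have pv (r : qpath Qx) : c (pelt k r) = (r == ptriv v)%:R.
  by rewrite /c /pelt mcoeff_mbas.
rewrite !pv -natrM mulnb.
case: (eqVneq p (ptriv v)) => [->|np] /=.
  rewrite pcomp1l; case: (eqVneq v (ptgt q)) => [_|nq] /=; first exact: pv.
  rewrite (lin0 cP); case: eqP => // eq; case/eqP: nq.
  by rewrite eq.
case: (eqVneq (psrc p) (ptgt q)) => [e|ne]; last first.
  by rewrite /pcomp (negPf ne) /= (lin0 cP).
have [r [-> tr sr ar]] := pcompE e; rewrite /= pv.
case: eqP => // er; case/eqP: np; apply: qpathP.
  by rewrite -tr er.
by move: ar; rewrite er /parr /=; case: (val p).2.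
Qed.

Lemma rels_proper : ~ ideal rels 1.
Proof.
suff h (x : kQ) : ideal rels x -> x@_(ptriv (ord0 : vert Qx)) = 0.
  by move=> /h; rewrite pone_triv => /eqP; rewrite oner_eq0.
have c0 a : (arrelt a)@_(ptriv (ord0 : vert Qx)) = 0.
  rewrite /arrelt /pelt mcoeff_mbas; case: eqP => // /(congr1 (@parr Qx)).
elim=> [|c u w [a [g [b [Gg ->]]]] _ IH]; first by rewrite mcoeff0.
rewrite mcoeffD mcoeffZ IH addr0 !coef_triv_mul.
suff -> : g@_(ptriv (ord0 : vert Qx)) = 0 by rewrite mulr0 mul0r mulr0.
by case: Gg => i; rewrite mcoeffB ?coef_triv_mul !c0 ?mulr0 subrr.
Qed.

Definition algA : algType k := quoalg rels_proper.
Definition arr_A (a : arrow N) : algA := qalg rels_proper (arrelt a).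
Definition vert_A : {lrmorphism kQ0 -> algA} :=
  qalg rels_proper \o vertincl (k := k) (Q := Qx).

(** The alternating word [a b a b ...] with [n] letters. *)
Fixpoint alt (a b : arrow N) (n : nat) : seq (arrow N) :=
  if n is m.+1 then a :: alt b a m else [::].

Lemma alt_wf (a b : arr Qx) n : src a = tgt b -> src b = tgt a ->
  wf_path (tgt a) (alt a b n).
Proof. by elim: n a b => //= n IH a b e1 e2; rewrite eqxx /= e1 IH. Qed.

Lemma s_alt_wf (a b : arr Qx) n : src a = tgt b -> src b = tgt a ->
  wf_path (tgt a) ((As (atgt a) : arr Qx) :: alt a b n).
Proof. by move=> e1 e2; rewrite /= eqxx; apply: alt_wf. Qed.

(** [P^n_(i+1)], [Q^n_i], [sP^n_(i+1)] and [sQ^n_i]; relevant for [n >= 1]. *)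
Definition wP (n : nat) (i : 'I_N) : qpath Qx :=
  Sub (hi i, alt (Ap i) (Aq i) n) (@alt_wf (Ap i) (Aq i) n erefl erefl).
Definition wQ (n : nat) (i : 'I_N) : qpath Qx :=
  Sub (lo i, alt (Aq i) (Ap i) n) (@alt_wf (Aq i) (Ap i) n erefl erefl).
Definition wsP (n : nat) (i : 'I_N) : qpath Qx :=
  Sub (hi i, As (hi i) :: alt (Ap i) (Aq i) n.-1)
      (@s_alt_wf (Ap i) (Aq i) n.-1 erefl erefl).
Definition wsQ (n : nat) (i : 'I_N) : qpath Qx :=
  Sub (lo i, As (lo i) :: alt (Aq i) (Ap i) n.-1)
      (@s_alt_wf (Aq i) (Ap i) n.-1 erefl erefl).

Definition amb (n : nat) : seq (qpath Qx) :=
  match n with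
  | 0 => [seq ptriv v | v : vert Qx]
  | 1 => [seq parrow (a : arr Qx) | a : arrow N]
  | _ => flatten [seq [:: wP n i; wQ n i; wsP n i; wsQ n i] | i : 'I_N]
  end.

Lemma words_in_amb n i :
  [/\ wP n.+1 i \in amb n.+1, wQ n.+1 i \in amb n.+1,
      wsP n.+1 i \in amb n.+1 & wsQ n.+1 i \in amb n.+1].
Proof.
case: n => [|n] /=.
  by split; [ have -> : wP 1 i = parrow (Ap i : arr Qx)
            | have -> : wQ 1 i = parrow (Aq i : arr Qx)
            | have -> : wsP 1 i = parrow (As (hi i) : arr Qx)
            | have -> : wsQ 1 i = parrow (As (lo i) : arr Qx) ];
    rewrite ?(map_f, mem_enum) //; apply: val_inj.
by split; apply/flattenP;
  exists [:: wP n.+2 i; wQ n.+2 i; wsP n.+2 i; wsQ n.+2 i];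
  rewrite ?(map_f _ (mem_enum _ _)) // !inE eqxx ?orbT.
Qed.

Definition kS_car (n : nat) : lmodType k := {ffun seq_sub (amb n) -> k^o}.
Definition kS_lact n (c : kQ0) (f : kS_car n) : kS_car n :=
  [ffun w => c (ptgt (ssval w)) * f w].
Definition kS_ract n (f : kS_car n) (c : kQ0) : kS_car n :=
  [ffun w => f w * c (psrc (ssval w))].

Fact kS_bimodP n : bimod_axioms (@kS_lact n) (@kS_ract n).
Proof.
split=> [f c x y|a c x y|f|a b f|b c x y|f c x y|f|a b f|a f b];
  apply/ffunP => w; rewrite !ffunE.
- by rewrite mulrDl -scalerAl.
- by rewrite mulrDr -scalerAr.
- by rewrite mul1r.
- by rewrite mulrA.
- by rewrite mulrDl -scalerAl.
- by rewrite mulrDr -scalerAr.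
- by rewrite mulr1.
- by rewrite mulrA.
- by rewrite mulrA.
Qed.
Definition kS (n : nat) : bimod kQ0 kQ0 := Bimod (@kS_bimodP n).

(** The basis vector of [kS n] given by the path [w]; it is [0] unless
    [w \in amb n]. *)
Definition kS_elt (n : nat) (w : qpath Qx) : kS n :=
  [ffun u => (ssval u == w)%:R].

(** [A_r] is [algA] as an [(algA, kQ0)]-bimodule, [A_l] as a
    [(kQ0, algA)]-bimodule. *)
Definition A_r : bimod algA kQ0 := regbimod idfun vert_A.
Definition A_l : bimod kQ0 algA := regbimod vert_A idfun.

Definition Pbm (n : nat) : bimod algA algA :=
  if n is 0 then tensor A_r A_l else tensor (tensor A_r (kS n)) A_l.

(** [a (x) b] in [Pbm 0] and [a (x) w (x) b] in [Pbm n.+1]. *)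
Definition tens2 (a b : algA) : Pbm 0 := @tens k algA kQ0 algA A_r A_l a b.
Definition tens3 (n : nat) (a : algA) (w : qpath Qx) (b : algA) : Pbm n.+1 :=
  @tens k algA kQ0 algA (tensor A_r (kS n.+1)) A_l
    (@tens k algA kQ0 kQ0 A_r (kS n.+1) a (kS_elt n.+1 w)) b.
Arguments tens3 {n} a w b.

Local Notation p i := (arr_A (Ap i)).
Local Notation q i := (arr_A (Aq i)).
Local Notation s j := (arr_A (As j)).
Local Notation "a ⊗ w ⊗ b" := (tens3 a w b)
  (at level 40, w at next level, b at next level).

(** The formulas for [∂_n] where [n = m.+2], for [n] even, resp. odd. *)
Definition even_formulas (m : nat) (D : Pbm m.+2 -> Pbm m.+1) : Prop :=
  let n := m.+2 in forall i : 'I_N,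
  [/\ D (1 ⊗ wQ n i ⊗ 1)
        = 1 ⊗ wQ n.-1 i ⊗ p i + q i ⊗ wP n.-1 i ⊗ 1 - 1 ⊗ wsQ n.-1 i ⊗ 1,
      D (1 ⊗ wP n i ⊗ 1)
        = 1 ⊗ wP n.-1 i ⊗ q i + p i ⊗ wQ n.-1 i ⊗ 1 - 1 ⊗ wsP n.-1 i ⊗ 1,
      D (1 ⊗ wsP n i ⊗ 1)
        = 1 ⊗ wsP n.-1 i ⊗ p i + s (hi i) ⊗ wP n.-1 i ⊗ 1
          - p i ⊗ wsQ n.-1 i ⊗ 1 - 1 ⊗ wP n.-1 i ⊗ s (lo i)
    & D (1 ⊗ wsQ n i ⊗ 1)
        = 1 ⊗ wsQ n.-1 i ⊗ q i + s (lo i) ⊗ wQ n.-1 i ⊗ 1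
          - q i ⊗ wsP n.-1 i ⊗ 1 - 1 ⊗ wQ n.-1 i ⊗ s (hi i)].

Definition odd_formulas (m : nat) (D : Pbm m.+2 -> Pbm m.+1) : Prop :=
  let n := m.+2 in forall i : 'I_N,
  [/\ D (1 ⊗ wQ n i ⊗ 1)
        = 1 ⊗ wQ n.-1 i ⊗ q i - q i ⊗ wP n.-1 i ⊗ 1 + 1 ⊗ wsQ n.-1 i ⊗ 1,
      D (1 ⊗ wP n i ⊗ 1)
        = 1 ⊗ wP n.-1 i ⊗ p i - p i ⊗ wQ n.-1 i ⊗ 1 + 1 ⊗ wsP n.-1 i ⊗ 1,
      D (1 ⊗ wsP n i ⊗ 1)
        = 1 ⊗ wsP n.-1 i ⊗ q i - s (hi i) ⊗ wP n.-1 i ⊗ 1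
          + p i ⊗ wsQ n.-1 i ⊗ 1 + 1 ⊗ wP n.-1 i ⊗ s (hi i)
    & D (1 ⊗ wsQ n i ⊗ 1)
        = 1 ⊗ wsQ n.-1 i ⊗ p i - s (lo i) ⊗ wQ n.-1 i ⊗ 1
          + q i ⊗ wsP n.-1 i ⊗ 1 + 1 ⊗ wQ n.-1 i ⊗ s (lo i)].

(** [eps] is [∂_0] and [d n] is [∂_(n+1)]. *)
Record differentials (eps : Pbm 0 -> diagbimod algA)
    (d : forall n, Pbm n.+1 -> Pbm n) : Prop := Differentials {
  eps_hom : bimod_hom eps;
  d_hom : forall n, bimod_hom (d n);
  eps_formula : eps (tens2 1 1) = 1 :> algA;
  d0_formula : forall w : arrow N,
    d 0%N (1 ⊗ parrow (w : arr Qx) ⊗ 1) = tens2 1 (arr_A w) - tens2 (arr_A w) 1;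
  d_even : forall m, ~~ odd m.+2 -> even_formulas (d m.+1);
  d_odd : forall m, odd m.+2 -> odd_formulas (d m.+1)
}.

End TheAlgebra.

(* Main.v *)
Require Import Defs.
From mathcomp Require Import all_boot all_algebra.
From mathcomp Require Import boolp zify.

(** The resolution is far from minimal, and this is what makes it exact.  Among
    the words of length n >= 2 call Q^n_i and P^n_(i+1) plain, and sQ^n_i and
    sP^n_(i+1) looped.  The boundary of a plain word of degree n + 1 contains,
    with coefficient 1 or -1, the looped word of degree n with the same
    beginning.  Hence in degrees at least 3 the bimodule map that sends a looped
    word back to its plain word, and plain words to 0, is a contracting homotopy
    ([partial_contraction], [exact_P_ge3]).

    In degree 2 the same map moves any cycle into the span of the plain words,
    and it remains to see that the differential is injective there ([exact_P2]).
    The looped words of degree 1 are the loops s_v, and s_v occurs in the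
    boundaries of the plain words Q^2_v and P^2_v only, so that the coefficients
    of these two words in a plain cycle are opposite to each other; the
    coefficient of p_(v+1) ties Q^2_v to P^2_(v+1) times q_v.  Starting from the
    vertex e_0, where there is no P^2, all coefficients vanish one after the
    other, because multiplication by q_v on the left is injective on e_(v+1) A:
    a path in A is determined by its ends and its length, counting s as two
    arrows ([parallel_pathA]), so that q_v can be cancelled ([q_retraction]).

    In degrees 1 and 0 the statement is the usual one for any quiver with
    relations.  The universal derivation of the path algebra with values in P_1
    sends each relation to the boundary of the corresponding word of degree 2,
    so modulo boundaries it descends to A ([algA_derivation]), and
    a (x) b |-> a D(b) splits the differential from P_1 to P_0 modulo boundaries
    ([exact_P1]).

    Every P_n is a direct sum of bimodules A e_u (x) e_v A over the field.  The
    records [cells] and [corner_free] say this by a universal property, from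
    which existence and uniqueness of the differentials and projectivity follow
    ([hom_lift], [hom_ext], [cf_projective]), and in which all calculations with
    the differentials take place. *)

Set Implicit Arguments.
Unset Strict Implicit.
Unset Printing Implicit Defensive.

Import GRing.Theory.
Local Open Scope ring_scope.
Local Notation pcomp := Defs.pcomp.
Local Notation span := Defs.span.

(** * Linear maps and bimodules *)

Lemma lin_comp (k : pzRingType) (U V W : lmodType k) (f : V -> W) (g : U -> V) :
  linear f -> linear g -> linear (f \o g).
Proof. by move=> lf lg c x y /=; rewrite lg lf. Qed.

Lemma lin_sub (k : comNzRingType) (U V : lmodType k) (f g : U -> V) :
  linear f -> linear g -> linear (fun x => f x - g x).
Proof.
by move=> lf lg c x y; rewrite lf lg scalerBr opprD addrACA.
Qed.

Lemma linN (k : pzRingType) (U V : lmodType k) (f : U -> V) :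
  linear f -> forall x, f (- x) = - f x.
Proof. by move=> lf x; rewrite -scaleN1r (linZ lf) scaleN1r. Qed.

Lemma lin_add (k : comNzRingType) (U V : lmodType k) (f g : U -> V) :
  linear f -> linear g -> linear (fun x => f x + g x).
Proof. by move=> lf lg c x y; rewrite lf lg scalerDr addrACA. Qed.

Lemma lin_cst0 (k : pzRingType) (U V : lmodType k) : linear (fun _ : U => 0 : V).
Proof. by move=> c x y; rewrite scaler0 addr0. Qed.

Section BimodTheory.
Variables (k : comNzRingType) (R S : algType k).
Implicit Types M N : bimod R S.

Section Acts.
Variable M : bimod R S.
Implicit Types (a b : R) (c d : S) (x y : M).

Lemma lactDr a x y : lact a (x + y) = lact a x + lact a y.
Proof. exact: linD (lact_linear_r (bimodP M) a) _ _. Qed.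
Lemma lactBr a x y : lact a (x - y) = lact a x - lact a y.
Proof. exact: linB (lact_linear_r (bimodP M) a) _ _. Qed.
Lemma lactNr a x : lact a (- x) = - lact a x.
Proof. exact: linN (lact_linear_r (bimodP M) a) _. Qed.
Lemma lact0r a : lact a (0 : M) = 0.
Proof. exact: lin0 (lact_linear_r (bimodP M) a). Qed.
Lemma lactZr a e x : lact a (e *: x) = e *: lact a x.
Proof. exact: linZ (lact_linear_r (bimodP M) a) _ _. Qed.
Lemma lactDl a b x : lact (a + b) x = lact a x + lact b x.
Proof. exact: linD (lact_linear_l (bimodP M) x) _ _. Qed.
Lemma lact0l x : lact (0 : R) x = 0.
Proof. exact: lin0 (lact_linear_l (bimodP M) x). Qed.
Lemma lactZl a e x : lact (e *: a) x = e *: lact a x.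
Proof. exact: linZ (lact_linear_l (bimodP M) x) _ _. Qed.
Lemma lact_sumr (I : Type) (r : seq I) (F : I -> M) a :
  lact a (\sum_(i <- r) F i) = \sum_(i <- r) lact a (F i).
Proof. exact: (lin_sum (lact_linear_r (bimodP M) a) r F). Qed.
Lemma lact1 x : lact (1 : R) x = x. Proof. exact: lact_one (bimodP M) x. Qed.
Lemma lactM a b x : lact (a * b) x = lact a (lact b x).
Proof. exact: lact_mul (bimodP M) a b x. Qed.

Lemma ractDl x y c : ract (x + y) c = ract x c + ract y c.
Proof. exact: linD (ract_linear_l (bimodP M) c) _ _. Qed.
Lemma ractBl x y c : ract (x - y) c = ract x c - ract y c.
Proof. exact: linB (ract_linear_l (bimodP M) c) _ _. Qed.
Lemma ractNl x c : ract (- x) c = - ract x c.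
Proof. exact: linN (ract_linear_l (bimodP M) c) _. Qed.
Lemma ract0l c : ract (0 : M) c = 0.
Proof. exact: lin0 (ract_linear_l (bimodP M) c). Qed.
Lemma ractZl e x c : ract (e *: x) c = e *: ract x c.
Proof. exact: linZ (ract_linear_l (bimodP M) c) _ _. Qed.
Lemma ractDr x c d : ract x (c + d) = ract x c + ract x d.
Proof. exact: linD (ract_linear_r (bimodP M) x) _ _. Qed.
Lemma ract0r x : ract x (0 : S) = 0.
Proof. exact: lin0 (ract_linear_r (bimodP M) x). Qed.
Lemma ractZr x e c : ract x (e *: c) = e *: ract x c.
Proof. exact: linZ (ract_linear_r (bimodP M) x) _ _. Qed.
Lemma ract_suml (I : Type) (r : seq I) (F : I -> M) c :
  ract (\sum_(i <- r) F i) c = \sum_(i <- r) ract (F i) c.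
Proof. exact: (lin_sum (ract_linear_l (bimodP M) c) r F). Qed.
Lemma ract1 x : ract x (1 : S) = x. Proof. exact: ract_one (bimodP M) x. Qed.
Lemma ractM x c d : ract x (c * d) = ract (ract x c) d.
Proof. exact: ract_mul (bimodP M) c d x. Qed.
Lemma lractA a x c : lact a (ract x c) = ract (lact a x) c.
Proof. exact: lract_assoc (bimodP M) a x c. Qed.
End Acts.

Lemma hom_comp M1 M2 M3 (g : M2 -> M3) (f : M1 -> M2) :
  bimod_hom g -> bimod_hom f -> bimod_hom (g \o f).
Proof.
move=> [lg gl gr] [lf fl fr]; split; first exact: lin_comp.
  by move=> a x /=; rewrite fl gl.
by move=> x b /=; rewrite fr gr.
Qed.

Lemma hom_sub M1 M2 (f g : M1 -> M2) :
  bimod_hom f -> bimod_hom g -> bimod_hom (fun x => f x - g x).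
Proof.
move=> [lf fl fr] [lg gl gr]; split; first exact: lin_sub.
  by move=> a x /=; rewrite fl gl lactBr.
by move=> x b /=; rewrite fr gr ractBl.
Qed.

Lemma hom_add M1 M2 (f g : M1 -> M2) :
  bimod_hom f -> bimod_hom g -> bimod_hom (fun x => f x + g x).
Proof.
move=> [lf fl fr] [lg gl gr]; split; first exact: lin_add.
  by move=> a x /=; rewrite fl gl lactDr.
by move=> x b /=; rewrite fr gr ractDl.
Qed.

Lemma hom_id M : bimod_hom (@id M).
Proof. by []. Qed.

Lemma hom_cst0 M1 M2 : bimod_hom (fun _ : M1 => 0 : M2).
Proof.
split; first exact: lin_cst0.
  by move=> a _; rewrite lact0r.
by move=> _ c; rewrite ract0l.
Qed.

Lemma hom_lin M1 M2 (f : M1 -> M2) : bimod_hom f -> linear f.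
Proof. by case. Qed.

End BimodTheory.

(** A predicate, so that the image of a differential can serve as a sub-bimodule
    and congruences modulo it need no quotient bimodule. *)
Record subbimod (k : comNzRingType) (R S : algType k) (M : bimod R S)
    (U : M -> Prop) : Prop := Subbimod {
  subbimod0 : U 0;
  subbimodP : forall c x y, U x -> U y -> U (c *: x + y);
  subbimod_lact : forall a x, U x -> U (lact a x);
  subbimod_ract : forall x b, U x -> U (ract x b)
}.

Lemma subbimodD (k : comNzRingType) (R S : algType k) (M : bimod R S)
  (U : M -> Prop) : subbimod U -> forall x y, U x -> U y -> U (x + y).
Proof. by move=> H x y Ux Uy; rewrite -[x]scale1r; apply: (subbimodP H). Qed.

Lemma subbimodN (k : comNzRingType) (R S : algType k) (M : bimod R S)
  (U : M -> Prop) : subbimod U -> forall x, U x -> U (- x).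
Proof.
by move=> H x Ux; rewrite -scaleN1r -[_ *: _]addr0; apply: (subbimodP H) => //; apply: subbimod0.
Qed.

Lemma hom_image_sub (k : comNzRingType) (R S : algType k) (M1 M2 : bimod R S)
  (f : M1 -> M2) : bimod_hom f -> subbimod (fun y => exists x, f x = y).
Proof.
move=> [lf fl fr]; split.
- by exists 0; rewrite (lin0 lf).
- by move=> c _ _ [x <-] [y <-]; exists (c *: x + y); rewrite lf.
- by move=> a _ [x <-]; exists (lact a x); rewrite fl.
- by move=> _ b [x <-]; exists (ract x b); rewrite fr.
Qed.

Lemma tensor_lift (k : comNzRingType) (R S T : algType k) (M : bimod R S)
    (N : bimod S T) (W : lmodType k) (f : M -> N -> W) :
  (forall n, linear (fun m => f m n)) -> (forall m, linear (f m)) ->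
  (forall m c n, f (ract m c) n = f m (lact c n)) ->
  exists2 g : tensor M N -> W, linear g & forall m n, g (tens m n) = f m n.
Proof.
move=> fl fr fb; pose F (p : M * N) := f p.1 p.2.
have F1 m m' n : F (m + m', n) = F (m, n) + F (m', n) by exact: (linD (fl n)).
have F2 m n n' : F (m, n + n') = F (m, n) + F (m, n') by exact: (linD (fr m)).
have F3 c m n : F (c *: m, n) = c *: F (m, n) by exact: (linZ (fl n)).
have F4 c m n : F (m, c *: n) = c *: F (m, n) by exact: (linZ (fr m)).
have F5 m c n : F (ract m c, n) = F (m, lact c n) by exact: fb.
refine (ex_intro2 _ _ _ (tensor_lift_linear F1 F2 F3 F4 F5) _).
by move=> m n; exact: (tensor_lift_tens F1 F2 F3 F4 F5).
Qed.

Lemma tens_linl (k : comNzRingType) (R S T : algType k) (M : bimod R S)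
  (N : bimod S T) (n : N) : linear (fun m : M => tens m n).
Proof. by move=> c x y; rewrite tensDl tensZl. Qed.
Lemma tens_linr (k : comNzRingType) (R S T : algType k) (M : bimod R S)
  (N : bimod S T) (m : M) : linear (fun n : N => tens m n).
Proof. by move=> c x y; rewrite tensDr tensZr. Qed.

(** * Arrow families satisfying the relations *)

Section Combinatorics.
Variable N : nat.
Lemma hi_inj : injective (@hi N). Proof. exact: lift_inj. Qed.
Lemma lo_inj : injective (@lo N).
Proof. by move=> i j /(congr1 val) e; apply: val_inj. Qed.

(** Counting the loops twice makes the defining relations homogeneous. *)
Definition arrow_wt (a : arrow N) : nat := if a is As _ then 2 else 1.
Definition path_wt (r : qpath (Qx N)) : nat := sumn [seq arrow_wt a | a <- parr r].
Definition vdist (j i : 'I_N.+1) : nat := (j - i) + (i - j).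

(** The defining relations, each one as an equation between two words. *)
Inductive rel_words : seq (arrow N) -> seq (arrow N) -> Prop :=
| rel_words_qp i : rel_words [:: Aq i; Ap i] [:: As (lo i)]
| rel_words_pq i : rel_words [:: Ap i; Aq i] [:: As (hi i)]
| rel_words_sp i : rel_words [:: As (hi i); Ap i] [:: Ap i; As (lo i)]
| rel_words_sq i : rel_words [:: As (lo i); Aq i] [:: Aq i; As (hi i)].
End Combinatorics.
Arguments hi_inj {N}.
Arguments lo_inj {N}.

Definition word (N : nat) (A : nzRingType) (arr : arrow N -> A)
    (l : seq (arrow N)) : A := \prod_(a <- l) arr a.

(** The relations s p = p s and s q = q s are not listed, being consequences of
    the two others; see [spE] and [sqE] below. *)
Record arrow_rels (k : fieldType) (N : nat) (A : algType k)
    (ev : 'I_N.+1 -> A) (arr : arrow N -> A) : Prop := ArrowRels {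
  evM : forall u v, ev u * ev v = if u == v then ev v else 0;
  sum_ev : \sum_v ev v = 1;
  ev_arr : forall v a, ev v * arr a = if v == atgt a then arr a else 0;
  arr_ev : forall v a, arr a * ev v = if asrc a == v then arr a else 0;
  qpE : forall i, arr (Aq i) * arr (Ap i) = arr (As (lo i));
  pqE : forall i, arr (Ap i) * arr (Aq i) = arr (As (hi i))
}.

Section NormalForm.
Variables (k : fieldType) (N : nat) (A : algType k).
Variables (ev : 'I_N.+1 -> A) (arr : arrow N -> A) (H : arrow_rels ev arr).
Local Notation p i := (arr (Ap i)).
Local Notation q i := (arr (Aq i)).
Local Notation s j := (arr (As j)).

Lemma spE i : s (hi i) * p i = p i * s (lo i).
Proof. by rewrite -(pqE H) -(qpE H) mulrA. Qed.
Lemma sqE i : s (lo i) * q i = q i * s (hi i).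
Proof. by rewrite -(pqE H) -(qpE H) mulrA. Qed.

Definition sumP : A := \sum_i p i.
Definition sumQ : A := \sum_i q i.
Definition sumS : A := \sum_j s j.

Lemma ev_sumP i : ev (hi i) * sumP = p i.
Proof.
rewrite /sumP mulr_sumr (bigD1 i) // big1 /= ?addr0 => [|j nj].
  by rewrite (ev_arr H) eqxx.
by rewrite (ev_arr H) (inj_eq hi_inj) eq_sym (negPf nj).
Qed.
Lemma ev_sumQ i : ev (lo i) * sumQ = q i.
Proof.
rewrite /sumQ mulr_sumr (bigD1 i) // big1 /= ?addr0 => [|j nj].
  by rewrite (ev_arr H) eqxx.
by rewrite (ev_arr H) (inj_eq lo_inj) eq_sym (negPf nj).
Qed.
Lemma ev_sumS j : ev j * sumS = s j.
Proof.
rewrite /sumS mulr_sumr (bigD1 j) // big1 /= ?addr0 => [|l nl].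
  by rewrite (ev_arr H) eqxx.
by rewrite (ev_arr H) eq_sym (negPf nl).
Qed.
Lemma sumS_ev j : sumS * ev j = s j.
Proof.
rewrite /sumS mulr_suml (bigD1 j) // big1 /= ?addr0 => [|l nl].
  by rewrite (arr_ev H) eqxx.
by rewrite (arr_ev H) (negPf nl).
Qed.

(** The relations s p = p s and s q = q s together: the sum of the loops is
    central, and paths can be compared up to its powers. *)
Lemma arr_sumS a : arr a * sumS = sumS * arr a.
Proof.
have {1}-> : arr a = arr a * ev (asrc a) by rewrite (arr_ev H) eqxx.
have {2}-> : arr a = ev (atgt a) * arr a by rewrite (ev_arr H) eqxx.
rewrite -mulrA ev_sumS (mulrA sumS) sumS_ev.
by case: a => i //=; rewrite ?spE ?sqE.
Qed.

(** The shortest path from i to j times a power of the sum of the loops.  One of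
    the exponents j - i and i - j, both truncated at 0, vanishes: [sumP] and
    [sumQ] move the vertex up and down by one. *)
Definition normal_form (j i : 'I_N.+1) (m : nat) : A :=
  sumS ^+ m * (ev j * sumP ^+ (j - i) * sumQ ^+ (i - j) * ev i).

(** An arrow p or q either prolongs the shortest path or undoes its last step;
    in the second case the two opposite arrows merge into a loop, and the
    exponent goes up by one. *)
Lemma arr_normal_form (a : arrow N) i m :
  exists m', arr a * normal_form (asrc a) i m = normal_form (atgt a) i m' /\
    (arrow_wt a + (m.*2 + vdist (asrc a) i) = m'.*2 + vdist (atgt a) i)%N.
Proof.
have cS X : arr a * (sumS ^+ m * X) = sumS ^+ m * (arr a * X).
  by rewrite !mulrA; congr (_ * _); apply: commrX; apply: arr_sumS.
rewrite /normal_form cS /vdist; case: a {cS} => [v|v|v]; rewrite /asrc /atgt /arrow_wt.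
- rewrite !(mulrA (p v)) (arr_ev H) eqxx.
  have hl : hi v = v.+1 :> nat by [].
  have ll : lo v = v :> nat by [].
  rewrite hl ll; case: (leqP i v) => iv.
    exists m; rewrite -ev_sumP -(mulrA _ sumP) -exprS -subSn //.
    have e1 : (i - v = 0)%N by lia.
    have e2 : (i - v.+1 = 0)%N by lia.
    by rewrite e1 e2; split=> //; lia.
  exists m.+1; have e1 : (v - i = 0)%N by lia.
  have e2 : (v.+1 - i = 0)%N by lia.
  have e3 : (i - v = (i - v.+1).+1)%N by lia.
  rewrite e1 e2 e3.
  split; last by lia.
  rewrite !expr0 !mulr1 exprS.
  have {1}-> : p v = p v * ev (lo v) by rewrite (arr_ev H) eqxx.
  rewrite !mulrA -(mulrA _ (ev (lo v))) ev_sumQ -(mulrA _ (p v)) (pqE H) -sumS_ev.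
  by rewrite exprSr !mulrA.
- rewrite !(mulrA (q v)) (arr_ev H) eqxx.
  have hl : hi v = v.+1 :> nat by [].
  have ll : lo v = v :> nat by [].
  rewrite hl ll; case: (leqP i v) => iv.
    exists m.+1; have e1 : (i - v = 0)%N by lia.
    have e2 : (i - v.+1 = 0)%N by lia.
    rewrite e1 e2 subSn //; split; last by lia.
    rewrite exprS !expr0 !mulr1.
    have {1}-> : q v = q v * ev (hi v) by rewrite (arr_ev H) eqxx.
    rewrite !mulrA -(mulrA _ (ev (hi v))) ev_sumP -(mulrA _ (q v)) (qpE H) -sumS_ev.
    by rewrite exprSr !mulrA.
  exists m; have e1 : (v - i = 0)%N by lia.
  have e2 : (v.+1 - i = 0)%N by lia.
  have e3 : (i - v = (i - v.+1).+1)%N by lia.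
  rewrite e1 e2 e3.
  split; last by lia.
  by rewrite !expr0 !mulr1 exprS (mulrA (ev (lo v))) ev_sumQ.
- exists m.+1; split; last by lia.
  by rewrite exprSr !mulrA -(mulrA _ (s v)) (arr_ev H) eqxx -(mulrA _ sumS) sumS_ev.
Qed.

End NormalForm.

Section Leibniz.
Variables (k : fieldType) (N : nat) (A : algType k).
Variables (ev : 'I_N.+1 -> A) (arr : arrow N -> A) (H : arrow_rels ev arr).
Variables (M : bimod A A) (m : arrow N -> M) (U : M -> Prop) (HU : subbimod U).

Lemma word_rel u v : rel_words u v -> word arr u = word arr v.
Proof.
by case=> i; rewrite /word !big_cons !big_nil !mulr1
  ?(qpE H) ?(pqE H) ?(spE H) ?(sqE H).
Qed.

(** The value on a word that the Leibniz rule forces on a derivation with values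
    [m] on the arrows and 0 on the vertices. *)
Fixpoint word_deriv (l : seq (arrow N)) : M :=
  if l is a :: l' then lact (arr a) (word_deriv l') + ract (m a) (word arr l') else 0.

Lemma word_deriv_cat l l' :
  word_deriv (l ++ l') = lact (word arr l) (word_deriv l') + ract (word_deriv l) (word arr l').
Proof.
elim: l => [|a l IH]; first by rewrite /word big_nil lact1 ract0l addr0.
rewrite /= IH /word big_cat /= big_cons lactM lactDr ractDl ractM -lractA.
by rewrite addrA.
Qed.

(** The condition under which the derivation with values [m] on the arrows sends
    the defining relations, hence the ideal they generate, into [U]. *)
Definition leibniz_rels : Prop := forall i,
  [/\ U (lact (arr (Aq i)) (m (Ap i)) + ract (m (Aq i)) (arr (Ap i)) - m (As (lo i))),
      U (lact (arr (Ap i)) (m (Aq i)) + ract (m (Ap i)) (arr (Aq i)) - m (As (hi i))),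
      U (lact (arr (As (hi i))) (m (Ap i)) + ract (m (As (hi i))) (arr (Ap i))
         - (lact (arr (Ap i)) (m (As (lo i))) + ract (m (Ap i)) (arr (As (lo i)))))
    & U (lact (arr (As (lo i))) (m (Aq i)) + ract (m (As (lo i))) (arr (Aq i))
         - (lact (arr (Aq i)) (m (As (hi i))) + ract (m (Aq i)) (arr (As (hi i)))))].

Lemma word_deriv_rel u v : leibniz_rels -> rel_words u v -> U (word_deriv u - word_deriv v).
Proof.
move=> R; case=> i; have [R1 R2 R3 R4] := R i;
  by rewrite /word_deriv /word !big_cons !big_nil !mulr1 !ract1 !lact0r !add0r.
Qed.

(** Both words have the same value in the algebra; of the three terms of the
    Leibniz rule only the one that differentiates the middle part is left. *)
Lemma word_deriv_rel3 u v x y : leibniz_rels -> rel_words u v ->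
  U (word_deriv (x ++ u ++ y) - word_deriv (x ++ v ++ y)).
Proof.
move=> R uv; rewrite !word_deriv_cat.
have ww : word arr (u ++ y) = word arr (v ++ y).
  by rewrite /word !big_cat /= -!/(word arr _) (word_rel uv).
rewrite ww opprD addrACA subrr addr0 (word_rel uv) -lactBr.
rewrite opprD addrACA subrr add0r -ractBl.
by apply: (subbimod_lact HU); apply: (subbimod_ract HU); apply: word_deriv_rel.
Qed.

Hypothesis m_l : forall a, lact (ev (atgt a)) (m a) = m a.

Lemma word_deriv_l a l : lact (ev (atgt a)) (word_deriv (a :: l)) = word_deriv (a :: l).
Proof. by rewrite /= lactDr -lactM (ev_arr H) eqxx lractA m_l. Qed.

End Leibniz.

(** * The algebra A *)

Section Alg.
Variables (k : fieldType) (N : nat).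
Local Notation A := (algA k N).
Local Notation p i := (arr_A k (@Ap N i)).
Local Notation q i := (arr_A k (@Aq N i)).
Local Notation s j := (arr_A k (@As N j)).
Local Notation qA := (qalg (@rels_proper k N)).

Definition vdelta (v : 'I_N.+1) : kQ0 k N := [ffun u => (u == v)%:R].
Definition ev (v : 'I_N.+1) : A := vert_A k N (vdelta v).

Lemma vdeltaE (c : kQ0 k N) : c = \sum_v c v *: vdelta v.
Proof.
apply/ffunP => u; transitivity (\sum_(v < N.+1) (c v : k) * (u == v)%:R).
  rewrite (bigD1 u) // big1 /= ?eqxx ?mulr1 ?addr0 // => v nv.
  by rewrite eq_sym (negPf nv) mulr0.
by rewrite sum_ffunE; apply: eq_bigr => v _; rewrite !ffunE.
Qed.

Lemma evE v : ev v = qA (pelt k (ptriv (v : vert (Qx N)))).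
Proof.
rewrite /ev /vert_A /=; congr (qalg _ _).
rewrite /vertincl (bigD1 v) // big1 /= ?addr0 => [|u nu].
  by rewrite ffunE eqxx scale1r.
by rewrite ffunE (negPf nu) scale0r.
Qed.

Lemma vert_AE c : vert_A k N c = \sum_v c v *: ev v.
Proof.
rewrite {1}[c]vdeltaE linear_sum; apply: eq_bigr => v _.
by rewrite linearZ.
Qed.

Lemma algA_sum_ev : \sum_v ev v = 1.
Proof.
have := vert_AE 1; rewrite (rmorph1 (vert_A k N)) => ->; apply: eq_bigr => v _.
by rewrite ffunE scale1r.
Qed.

Lemma algA_evM u v : ev u * ev v = if u == v then ev v else 0.
Proof.
rewrite /ev -rmorphM.
have -> : vdelta u * vdelta v = if u == v then vdelta v else 0.
  apply/ffunP => w; rewrite !ffunE; case: (eqVneq u v) => [->|nuv].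
    by rewrite !ffunE; case: eqP => _; rewrite ?mulr1 ?mulr0.
  rewrite ffunE; case: (eqVneq w u) => [->|_]; last by rewrite mul0r.
  by rewrite (negPf nuv) mulr0.
by case: ifP => // _; rewrite rmorph0.
Qed.

Lemma ev_idem v : ev v * ev v = ev v.
Proof. by rewrite algA_evM eqxx. Qed.

Lemma ev_vert (c : kQ0 k N) v : vert_A k N c * ev v = c v *: ev v.
Proof.
rewrite vert_AE mulr_suml (bigD1 v) // big1 /= ?addr0 => [|u nu].
  by rewrite -scalerAl ev_idem.
by rewrite -scalerAl algA_evM (negPf nu) scaler0.
Qed.

Lemma vert_ev (c : kQ0 k N) v : ev v * vert_A k N c = c v *: ev v.
Proof.
rewrite vert_AE mulr_sumr (bigD1 v) // big1 /= ?addr0 => [|u nu].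
  by rewrite -scalerAr ev_idem.
by rewrite -scalerAr algA_evM eq_sym (negPf nu) scaler0.
Qed.

Definition pathA (r : qpath (Qx N)) : A := qA (pelt k r).
Local Notation wordA := (word (@arr_A k N)).

Lemma pathAM r r' : pathA r * pathA r' = oapp pathA 0 (pcomp r r').
Proof.
rewrite /pathA -qalgM [X in qalg _ X = _]peltM.
by case: (pcomp r r') => //=; exact: linear0 (qA).
Qed.

Lemma ev_pathA v r : ev v * pathA r = if v == ptgt r then pathA r else 0.
Proof.
by rewrite evE -/(pathA _) pathAM pcomp1l; case: ifP.
Qed.

Lemma pathA_ev v r : pathA r * ev v = if psrc r == v then pathA r else 0.
Proof.
by rewrite evE -/(pathA _) pathAM pcomp1r; case: ifP.
Qed.

Lemma algA_ev_arr v a : ev v * arr_A k a = if v == atgt a then arr_A k a else 0.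
Proof. exact: ev_pathA. Qed.
Lemma algA_arr_ev v a : arr_A k a * ev v = if asrc a == v then arr_A k a else 0.
Proof. exact: pathA_ev. Qed.

Lemma pathA_triv v : pathA (ptriv (v : vert (Qx N))) = ev v.
Proof. by rewrite evE. Qed.

(** Induction on the number of arrows, peeling off the last arrow traversed. *)
Lemma qpath_ind (P : qpath (Qx N) -> Prop) :
  (forall v, P (ptriv v)) ->
  (forall (a : arrow N) (r u : qpath (Qx N)), asrc a = ptgt r ->
     ptgt u = atgt a -> psrc u = psrc r -> parr u = a :: parr r ->
     pathA u = arr_A k a * pathA r -> P r -> P u) -> forall r, P r.
Proof.
move=> P0 PS [[t l] /= w]; elim: l t w => [|a l IH] t w.
  by rewrite (_ : exist _ _ _ = ptriv t) //; apply: val_inj.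
have /andP[/eqP ta wl] : (atgt a == t) && wf_path (Q := Qx N) (asrc a) l by [].
pose r : qpath (Qx N) := Sub (asrc a, l) wl.
have [|u [cu tu su au]] := @pcompE (Qx N) (parrow (a : arr (Qx N))) r; first by [].
have eu : exist _ (t, a :: l) w = u by apply: qpathP; rewrite ?tu ?au //= /ptgt /=.
rewrite eu; apply: (PS a r) => //; last exact: IH.
by rewrite [RHS]pathAM cu.
Qed.

Lemma pathA_word r : pathA r = ev (ptgt r) * wordA (parr r).
Proof.
elim/qpath_ind: r => [v|a r u ar tu su au pu IH].
  by rewrite pathA_triv /word big_nil mulr1.
rewrite tu au pu /word big_cons IH !mulrA algA_arr_ev ar eqxx; congr (_ * _).
by rewrite algA_ev_arr eqxx.
Qed.

Lemma qA_ind (P : A -> Prop) :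
  P 0 -> (forall c r x, P x -> P (c *: pathA r + x)) -> forall x, P x.
Proof.
move=> P0 PS x; rewrite -[x]qalgK.
elim/malg_ind: (repr (x : quo _)) => [|c r y IH].
  by rewrite (_ : qalg _ 0 = 0) //; exact: linear0 (qA).
rewrite -/(pelt k r) qalgD qalgZ; exact: PS.
Qed.

Lemma rel_A x : @rels k N x -> qA x = 0.
Proof.
move=> rx; apply/qpi_eq0/span_gen; exists 1, x, 1.
by rewrite mul1r mulr1.
Qed.

Lemma qpA i : q i * p i = s (lo i).
Proof.
apply/eqP; rewrite -subr_eq0 /arr_A -qalgM -(linearB (qA)).
by apply/eqP/rel_A/rel_qp.
Qed.
Lemma pqA i : p i * q i = s (hi i).
Proof.
apply/eqP; rewrite -subr_eq0 /arr_A -qalgM -(linearB (qA)).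
by apply/eqP/rel_A/rel_pq.
Qed.
End Alg.

Section PathsInA.
Variables (k : fieldType) (N : nat).
Local Notation A := (algA k N).
Local Notation p i := (arr_A k (@Ap N i)).
Local Notation q i := (arr_A k (@Aq N i)).
Local Notation s j := (arr_A k (@As N j)).
Local Notation ev := (@ev k N).
Local Notation pathA := (@pathA k N).
Local Notation qA := (qalg (@rels_proper k N)).
Local Notation nf := (normal_form ev (@arr_A k N)).

Lemma algA_rels : arrow_rels ev (@arr_A k N).
Proof.
split; [exact: algA_evM | exact: algA_sum_ev | exact: algA_ev_arr
  | exact: algA_arr_ev | exact: qpA | exact: pqA].
Qed.

(** The exponent is recorded by the weight, as the relations are homogeneous. *)
Lemma path_normal_form r : exists m, pathA r = nf (ptgt r) (psrc r) m /\
  path_wt r = (m.*2 + vdist (ptgt r) (psrc r))%N.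
Proof.
elim/(@qpath_ind k N): r => [v|a r u ar tu su au pu [m [pr wr]]].
  exists 0; rewrite pathA_triv /normal_form /path_wt /vdist /psrc /ptgt /=.
  by rewrite !subnn !expr0 mul1r !mulr1 (evM algA_rels) eqxx.
rewrite tu su pu pr /path_wt au /= -/(path_wt r) wr -ar.
have [m' [-> ->]] := arr_normal_form algA_rels a (psrc r) m.
exact: (ex_intro _ m' (conj erefl erefl)).
Qed.

Definition parallel (u v : qpath (Qx N)) :=
  [/\ ptgt u = ptgt v, psrc u = psrc v & path_wt u = path_wt v].

Lemma pcomp_wt (x u w : qpath (Qx N)) : pcomp x u = Some w ->
  [/\ ptgt w = ptgt x, psrc w = psrc u & path_wt w = path_wt x + path_wt u]%N.
Proof.
case: (eqVneq (psrc x) (ptgt u)) => [e|ne]; last by rewrite /Defs.pcomp (negPf ne).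
have [w' [-> tw sw aw]] := pcompE e => -[<-]; split=> //.
by rewrite /path_wt aw map_cat sumn_cat.
Qed.

Lemma parallel_pcomp (x u v y : qpath (Qx N)) : parallel u v ->
  match obind (fun z => pcomp z y) (pcomp x u), obind (fun z => pcomp z y) (pcomp x v) with
  | Some a, Some b => parallel a b | None, None => True | _, _ => False end.
Proof.
move=> [e1 e2 e3].
case: (eqVneq (psrc x) (ptgt u)) => [e|ne]; last first.
  by rewrite /Defs.pcomp -e1 (negPf ne).
have [a [ca ta sa _]] := pcompE e.
have [b [cb tb sb _]] := pcompE (etrans e e1).
rewrite ca cb /=; case: (eqVneq (psrc u) (ptgt y)) => [e'|ne']; last first.
  by rewrite /Defs.pcomp sa sb -e2 (negPf ne').
have [c [cc tc sc _]] := @pcompE _ a y (etrans sa e').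
have [d [cd td sd _]] := @pcompE _ b y (etrans sb (etrans (esym e2) e')).
rewrite cc cd; split; rewrite ?tc ?td ?ta ?tb ?sc ?sd //.
have [_ _ ->] := pcomp_wt cc; have [_ _ ->] := pcomp_wt cd.
by have [_ _ ->] := pcomp_wt ca; have [_ _ ->] := pcomp_wt cb; rewrite e3.
Qed.

Lemma arrelt2 (a b : arrow N) : asrc a = atgt b -> exists u : qpath (Qx N),
  [/\ arrelt k a * arrelt k b = pelt k u, ptgt u = atgt a, psrc u = asrc b &
      parr u = [:: a; b]].
Proof.
move=> e; have [u [cu tu su au]] :=
  @pcompE (Qx N) (parrow (a : arr (Qx N))) (parrow (b : arr (Qx N))) e.
exists u; split; rewrite ?tu ?su //.
by rewrite /arrelt [LHS]peltM cu.
Qed.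

Lemma rels_parallel g : @rels k N g -> exists u v,
  [/\ g = pelt k u - pelt k v, parallel u v & rel_words (parr u) (parr v)].
Proof.
case=> i.
- have [u [-> tu su wu]] := @arrelt2 (Aq i) (Ap i) erefl.
  exists u, (parrow (As (lo i) : arr (Qx N))); split=> //.
    by rewrite /parallel /path_wt tu su wu.
  by rewrite wu; exact: rel_words_qp.
- have [u [-> tu su wu]] := @arrelt2 (Ap i) (Aq i) erefl.
  exists u, (parrow (As (hi i) : arr (Qx N))); split=> //.
    by rewrite /parallel /path_wt tu su wu.
  by rewrite wu; exact: rel_words_pq.
- have [u [-> tu su wu]] := @arrelt2 (As (hi i)) (Ap i) erefl.
  have [v [-> tv sv wv]] := @arrelt2 (Ap i) (As (lo i)) erefl.
  exists u, v; split=> //; first by rewrite /parallel /path_wt tu su wu tv sv wv.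
  by rewrite wu wv; exact: rel_words_sp.
- have [u [-> tu su wu]] := @arrelt2 (As (lo i)) (Aq i) erefl.
  have [v [-> tv sv wv]] := @arrelt2 (Aq i) (As (hi i)) erefl.
  exists u, v; split=> //; first by rewrite /parallel /path_wt tu su wu tv sv wv.
  by rewrite wu wv; exact: rel_words_sq.
Qed.

(** The ends and the weight determine the normal form. *)
Lemma parallel_pathA u v : parallel u v -> pathA u = pathA v.
Proof.
move=> [e1 e2 e3]; have [m [-> w1]] := path_normal_form u; have [n [-> w2]] := path_normal_form v.
rewrite e1 e2; congr (nf _ _ _).
by move: e3; rewrite w1 w2 e1 e2 => /addIn/double_inj.
Qed.

Lemma span_sub (V : lmodType k) (G U : V -> Prop) : U 0 ->
  (forall c x y, U x -> U y -> U (c *: x + y)) -> (forall x, G x -> U x) ->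
  forall x, span G x -> U x.
Proof. by move=> U0 UP GU x; elim=> // c u v /GU Gu _; apply: UP. Qed.

(** The ideal is spanned by the products of a relation with two paths, so a
    linear map has to be tested on these only. *)
Lemma ideal_image (V : lmodType k) (U : V -> Prop) (f : kQ k N -> V) :
  U 0 -> (forall c x y, U x -> U y -> U (c *: x + y)) -> linear f ->
  (forall x g y, @rels k N g -> U (f (pelt k x * g * pelt k y))) ->
  forall x, ideal (@rels k N) x -> U (f x).
Proof.
move=> U0 UP lf H; apply: span_sub; first by rewrite (lin0 lf).
  by move=> c x y Ux Uy; rewrite lf; apply: UP.
move=> _ [a [g [b [rg ->]]]].
elim/malg_ind: a => [|c r a IH]; first by rewrite !mul0r (lin0 lf).
rewrite -/(pelt k r) !mulrDl -!scalerAl lf; apply: (UP _ _ _) => // {IH a c}.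
elim/malg_ind: b => [|c r' b IH]; first by rewrite mulr0 (lin0 lf).
by rewrite -/(pelt k r') mulrDr -scalerAr lf; apply: (UP _ _ _) => //; apply: H.
Qed.

Lemma path_triple (x u y : qpath (Qx N)) :
  (pelt k x : kQ k N) * pelt k u * pelt k y =
    oapp (@pelt k (Qx N)) 0 (obind (fun z => pcomp z y) (pcomp x u)).
Proof.
rewrite [X in X * _]peltM; case: (pcomp x u) => [z|] /=; last by rewrite mul0r.
by rewrite peltM.
Qed.

Lemma quolift_lin (V W : lmodType k) (G : V -> Prop) (f : {linear V -> W}) :
  (forall x, G x -> f x = 0) -> linear (quolift f : quo G -> W).
Proof.
move=> f0 c x y; rewrite -[x]qpiK -[y]qpiK -[c *: _ + _]linearP.
by rewrite !quoliftE // linearP.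
Qed.

(** The two sides of a relation are parallel, and remain so after multiplication
    by paths. *)
Lemma algA_graded_map (V : lmodType k) (F : 'I_N.+1 -> 'I_N.+1 -> nat -> V) :
  exists f : A -> V, linear f /\
    forall r, f (pathA r) = F (ptgt r) (psrc r) (path_wt r).
Proof.
pose h (r : qpath (Qx N)) := F (ptgt r) (psrc r) (path_wt r).
have lh : linear (linext h : pathalg k (Qx N) -> V) := linext_is_linear h.
have kill x : ideal_gens (@rels k N) x -> (linext h : pathalg k (Qx N) -> V) x = 0.
  move=> gx; apply: (@ideal_image V (fun v => v = 0) (linext h)) => //.
  - by move=> c u v -> ->; rewrite scaler0 addr0.
  - move=> y g z /rels_parallel [u [v [-> uv _]]].
    rewrite mulrBr mulrBl !path_triple (linB lh).
    have := parallel_pcomp y z uv.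
    case: obind => [a|]; case: obind => [b|] //=; last by rewrite subrr.
    by move=> [e1 e2 e3]; rewrite /pelt !linextU /h e1 e2 e3 subrr.
  - exact: span_gen.
exists (quolift (linext h : pathalg k (Qx N) -> V)); split.
  exact: quolift_lin.
move=> r; rewrite -[pathA r]/(qA (pelt k r)) /qalg quoliftE //.
exact: linextU.
Qed.

(** A representative of each class of parallel paths. *)
Definition pick_path (j i : 'I_N.+1) (w : nat) : option (qpath (Qx N)) :=
  if pselect (exists r : qpath (Qx N), [/\ ptgt r = j, psrc r = i & path_wt r = w])
    is left e then Some (projT1 (cid e)) else None.

Lemma pick_pathP (r : qpath (Qx N)) :
  exists2 r', pick_path (ptgt r) (psrc r) (path_wt r) = Some r' & parallel r' r.
Proof.
rewrite /pick_path; case: pselect => [e|[]]; last by exists r.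
by exists (projT1 (cid e)) => //; case: (cid e).
Qed.

(** Replacing a path by the representative of its class does not change its
    value in the algebra; this gives a linear, though not multiplicative,
    section. *)
Lemma algA_section : exists2 f : A -> kQ k N, linear f & forall x, qA (f x) = x.
Proof.
have [f [lf fr]] := algA_graded_map
  (fun j i w => oapp (@pelt k (Qx N)) 0 (pick_path j i w) : kQ k N).
exists f => //; elim/qA_ind => [|c r x IH].
  by rewrite (lin0 lf); exact: linear0 qA.
have fE : qA (f (pathA r)) = pathA r.
  rewrite fr; have [r' e /parallel_pathA e'] := pick_pathP r.
  by rewrite e -e'.
by rewrite lf qalgD qalgZ IH fE.
Qed.

(** Cancellation of q_v on the left: the class of parallel paths of q_v r
    determines that of r, whose weight is smaller by one. *)
Lemma q_retraction v : exists f : A -> A, linear f /\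
  forall b, f (q v * b) = ev (hi v) * b.
Proof.
have [f [lf fr]] := algA_graded_map (fun j i w => oapp pathA 0 (pick_path (hi v) i w.-1)).
exists f; split=> //.
elim/qA_ind => [|c r x IH]; first by rewrite !mulr0 (lin0 lf).
have base : f (q v * pathA r) = ev (hi v) * pathA r.
  rewrite ev_pathA; case: eqP => [e|ne]; last first.
    have -> : q v * pathA r = 0; last exact: lin0 lf.
    have -> : q v = q v * ev (hi v) by rewrite (arr_ev algA_rels) eqxx.
    by rewrite -(mulrA (q v)) ev_pathA; case: eqP => // _; exact: mulr0.
  have [u [cu tu su au]] := @pcompE (Qx N) (parrow (Aq v : arr (Qx N))) r e.
  have -> : q v * pathA r = pathA u by rewrite [LHS]pathAM cu.
  rewrite fr su /path_wt au /= -/(path_wt r).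
  by have := pick_pathP r; rewrite -e => -[r' -> /parallel_pathA].
rewrite (mulrDr (q v)) (mulrDr (ev _)) -(scalerAr c (q v)) -(scalerAr c (ev _)).
by rewrite lf IH base.
Qed.

End PathsInA.

Section Derivation.
Variables (k : fieldType) (N : nat).
Local Notation A := (algA k N).
Local Notation arrA := (@arr_A k N).
Local Notation ev := (@ev k N).
Local Notation pathA := (@pathA k N).
Local Notation qA := (qalg (@rels_proper k N)).

(** Every path is built from a vertex by multiplying with arrows on the left. *)
Lemma algA_ind (Q : A -> Prop) :
  Q 0 -> (forall c x y, Q x -> Q y -> Q (c *: x + y)) -> (forall v, Q (ev v)) ->
  (forall a x, Q x -> Q (arrA a * x)) -> forall x, Q x.
Proof.
move=> Q0 QP Qe Qa; elim/qA_ind => // c r x Qx; apply: (QP _ _ _) => // {c x Qx}.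
elim/(@qpath_ind k N): r => [v|a r u _ _ _ _ -> Qr].
  by rewrite pathA_triv.
exact: Qa.
Qed.

Variables (M : bimod A A) (m : arrow N -> M) (U : M -> Prop) (HU : subbimod U).
Hypotheses (m_l : forall a, lact (ev (atgt a)) (m a) = m a).
Hypotheses (m_r : forall a, ract (m a) (ev (asrc a)) = m a).
Hypothesis R : leibniz_rels arrA m U.

Definition path_deriv (x : kQ k N) : M :=
  linext (fun r : qpath (Qx N) => word_deriv arrA m (parr r)) x.

Lemma path_deriv_linear : linear path_deriv.
Proof. exact: linext_is_linear. Qed.

Lemma path_deriv_pelt r : path_deriv (pelt k r) = word_deriv arrA m (parr r).
Proof. by rewrite /path_deriv /pelt linextU. Qed.

Lemma path_deriv_ideal x : ideal (@rels k N) x -> U (path_deriv x).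
Proof.
apply: ideal_image; first exact: subbimod0 HU.
- exact: subbimodP HU.
- exact: path_deriv_linear.
move=> y g z /rels_parallel [u [v [-> uv rw]]].
rewrite mulrBr mulrBl !path_triple (linB path_deriv_linear).
have := parallel_pcomp y z uv.
case e1: obind => [a|]; case e2: obind => [b|] //= _; last first.
  by rewrite subrr; exact: subbimod0 HU.
have pa (w c : qpath (Qx N)) : obind (fun t => pcomp t z) (pcomp y w) = Some c ->
    parr c = parr y ++ parr w ++ parr z.
  case: (eqVneq (psrc y) (ptgt w)) => [e|ne]; last by rewrite /Defs.pcomp (negPf ne).
  have [w' [-> tw sw aw]] := pcompE e => /=.
  case: (eqVneq (psrc w') (ptgt z)) => [e'|ne']; last by rewrite /Defs.pcomp (negPf ne').
  by have [w'' [-> _ _ aw']] := pcompE e' => -[<-]; rewrite aw' aw catA.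
rewrite !path_deriv_pelt (pa _ _ e1) (pa _ _ e2).
exact: (word_deriv_rel3 (algA_rels k N) HU).
Qed.

(** On a path that composes with the arrow this is the definition of
    [word_deriv].  If they do not compose, both terms vanish, because [m] and the derivative
    of the path are supported in the right corners. *)
Lemma path_deriv_arr a x :
  path_deriv (arrelt k a * x) = lact (arrA a) (path_deriv x) + ract (m a) (qA x).
Proof.
elim/malg_ind: x => [|c r x IH].
  rewrite mulr0 (lin0 path_deriv_linear) lact0r (_ : qA 0 = 0) ?ract0r ?addr0 //.
  exact: linear0 qA.
rewrite -/(pelt k r) mulrDr -scalerAr !path_deriv_linear IH qalgD qalgZ.
rewrite lactDr lactZr ractDr ractZr [RHS]addrACA -scalerDr; congr (_ *: _ + _).
rewrite -/(pathA r).
rewrite path_deriv_pelt /arrelt.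
case: (eqVneq (asrc a) (ptgt r)) => [e|ne].
  have [u [cu tu su au]] := @pcompE (Qx N) (parrow (a : arr (Qx N))) r e.
  rewrite [X in path_deriv X]peltM cu /= path_deriv_pelt au /=; congr (_ + _).
  by rewrite pathA_word ractM -e m_r.
have -> : pelt k (parrow (a : arr (Qx N))) * pelt k r = 0 :> kQ k N.
  by rewrite [LHS]peltM /Defs.pcomp (negPf ne).
rewrite (lin0 path_deriv_linear) -(m_r a) -ractM ev_pathA (negPf ne) ract0r addr0.
case er : (parr r) => [|b l]; first by rewrite lact0r.
have eb : atgt b = ptgt r.
  have : wf_path (ptgt r) (parr r) := valP r.
  by rewrite er => /andP[/eqP].
rewrite -(word_deriv_l (algA_rels k N) m_l) -lactM (arr_ev (algA_rels k N)) eb.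
by rewrite (negPf ne) lact0l.
Qed.

(** The derivation of the path algebra is pulled back along the linear section.
    The section is multiplicative modulo the ideal, which goes into [U], so the
    Leibniz rule survives modulo [U]. *)
Lemma algA_derivation : exists2 D : A -> M, linear D &
  forall a x, U (D (arrA a * x) - (lact (arrA a) (D x) + ract (m a) x)).
Proof.
have [f lf fK] := algA_section k N.
exists (path_deriv \o f); first exact: lin_comp path_deriv_linear lf.
move=> a x /=; have := path_deriv_arr a (f x); rewrite fK => <-.
rewrite -(linB path_deriv_linear); apply: path_deriv_ideal.
have e : qA (f (arrA a * x)) = qA (arrelt k a * f x) by rewrite fK qalgM fK.
exact/(qpi_eq _ _ _).1.
Qed.

End Derivation.

(** * Bimodules freely generated in corners *)

Section CornerFree.
Variables (k : fieldType) (I : finType) (A : algType k) (ev : I -> A).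
Hypothesis evM : forall u v, ev u * ev v = if u == v then ev v else 0.

(** [t a g b] stands for the tensor a (x) g (x) b, where g has target [tg g] and
    source [sr g]; the idempotents pass through the tensor signs to g. *)
Record cells (P : bimod A A) (G : Type) (tg sr : G -> I)
    (t : A -> G -> A -> P) : Prop := Cells {
  cell_linl : forall g b, linear (fun a => t a g b);
  cell_linr : forall a g, linear (t a g);
  cell_evl : forall a g b, t (a * ev (tg g)) g b = t a g b;
  cell_evr : forall a g b, t a g (ev (sr g) * b) = t a g b;
  cell_lact : forall c a g b, lact c (t a g b) = t (c * a) g b;
  cell_ract : forall a g b c, ract (t a g b) c = t a g (b * c)
}.

(** P is the direct sum of the bimodules A e_(tg g) (x) e_(sr g) A.  The lifts
    are merely linear maps: the splittings used for exactness in the degrees 1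
    and 2 are linear on one side only. *)
Record corner_free (P : bimod A A) (G : Type) (tg sr : G -> I)
    (t : A -> G -> A -> P) : Prop := CornerFree {
  cf_cells : cells tg sr t;
  cf_ind : forall Q : P -> Prop, Q 0 ->
    (forall a g b x, Q x -> Q (t a g b + x)) -> forall x, Q x;
  cf_lift : forall (V : lmodType k) (F : A -> G -> A -> V),
    (forall g b, linear (fun a => F a g b)) -> (forall a g, linear (F a g)) ->
    (forall a g b, F (a * ev (tg g)) g b = F a g b) ->
    (forall a g b, F a g (ev (sr g) * b) = F a g b) ->
    exists2 f : P -> V, linear f & forall a g b, f (t a g b) = F a g b
}.

(** The elements that can be images of a generator with target u and source v. *)
Definition corner (M : bimod A A) (u v : I) (y : M) : Prop :=
  lact (ev u) y = y /\ ract y (ev v) = y.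

Lemma cornerD (M : bimod A A) u v (x y : M) :
  corner u v x -> corner u v y -> corner u v (x + y).
Proof. by move=> [xl xr] [yl yr]; split; rewrite ?lactDr ?ractDl ?xl ?xr ?yl ?yr. Qed.

Lemma cornerZ (M : bimod A A) u v c (x : M) : corner u v x -> corner u v (c *: x).
Proof. by move=> [xl xr]; split; rewrite ?lactZr ?ractZl ?xl ?xr. Qed.

Lemma cornerB (M : bimod A A) u v (x y : M) :
  corner u v x -> corner u v y -> corner u v (x - y).
Proof. by move=> cx cy; rewrite -scaleN1r; apply: cornerD => //; apply: cornerZ. Qed.

Lemma corner0 (M : bimod A A) u v : corner u v (0 : M).
Proof. by split; rewrite ?lact0r ?ract0l. Qed.

Lemma corner_if (M : bimod A A) u v (x : M) (b : bool) :
  (b -> corner u v x) -> corner u v (if b then x else 0).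
Proof. by case: b => [/(_ isT)|_] //; exact: corner0. Qed.

Lemma corner_proj (M : bimod A A) u v (y : M) :
  corner u v (lact (ev u) (ract y (ev v))).
Proof.
by split; rewrite -?lactM ?evM ?eqxx // -lractA -ractM evM eqxx.
Qed.

Lemma hom_corner (M1 M2 : bimod A A) (f : M1 -> M2) u v y :
  bimod_hom f -> corner u v y -> corner u v (f y).
Proof. by move=> [_ fl fr] [yl yr]; split; rewrite -?fl -?fr ?yl ?yr. Qed.

Section Cells.
Variables (P : bimod A A) (G : Type) (tg sr : G -> I) (t : A -> G -> A -> P).
Hypothesis C : cells tg sr t.

Lemma cell_decomp a g b : t a g b = lact a (ract (t 1 g 1) b).
Proof. by rewrite (cell_ract C) (cell_lact C) mul1r mulr1. Qed.

Lemma cell_corner g : corner (tg g) (sr g) (t 1 g 1).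
Proof.
split; first by rewrite (cell_lact C) mulr1 -{1}[ev _]mul1r (cell_evl C).
by rewrite (cell_ract C) mul1r -{1}[ev _]mulr1 (cell_evr C).
Qed.

Lemma cell_lact_ev u g b : u = tg g -> lact (ev u) (t 1 g b) = t 1 g b.
Proof. by move=> ->; rewrite (cell_lact C) mulr1 -{1}[ev _]mul1r (cell_evl C). Qed.
Lemma cell_lact_ev' u a g b : ev u * a = a -> lact (ev u) (t a g b) = t a g b.
Proof. by move=> e; rewrite (cell_lact C) e. Qed.
Lemma cell_ract_ev v a g : v = sr g -> ract (t a g 1) (ev v) = t a g 1.
Proof. by move=> ->; rewrite (cell_ract C) mul1r -{1}[ev _]mulr1 (cell_evr C). Qed.
Lemma cell_ract_ev' v a g b : b * ev v = b -> ract (t a g b) (ev v) = t a g b.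
Proof. by move=> e; rewrite (cell_ract C) e. Qed.

Lemma hom_cell (M : bimod A A) (f : P -> M) a g b :
  bimod_hom f -> f (t a g b) = lact a (ract (f (t 1 g 1)) b).
Proof. by move=> [_ fl fr]; rewrite cell_decomp fl fr. Qed.
End Cells.

Section Free.
Variables (P : bimod A A) (G : Type) (tg sr : G -> I) (t : A -> G -> A -> P).
Hypothesis F : corner_free tg sr t.
Let C := cf_cells F.

Lemma cf_ext (V : lmodType k) (f f' : P -> V) : linear f -> linear f' ->
  (forall a g b, f (t a g b) = f' (t a g b)) -> f =1 f'.
Proof.
move=> lf lf' e; apply: (cf_ind F) => [|a g b x IH]; first by rewrite !lin0.
by rewrite (linD lf) (linD lf') IH e.
Qed.

Lemma hom_ext (M : bimod A A) (f f' : P -> M) : bimod_hom f -> bimod_hom f' ->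
  (forall g, f (t 1 g 1) = f' (t 1 g 1)) -> f =1 f'.
Proof.
move=> hf hf' e; apply: cf_ext; [exact: hom_lin hf | exact: hom_lin hf' |].
by move=> a g b; rewrite (hom_cell C a g b hf) (hom_cell C a g b hf') e.
Qed.

(** A bimodule map is obtained from the linear lift of a (x) g (x) b |-> a y_g b. *)
Lemma hom_lift (M : bimod A A) (y : G -> M) :
  (forall g, corner (tg g) (sr g) (y g)) ->
  exists f : P -> M, bimod_hom f /\ forall g, f (t 1 g 1) = y g.
Proof.
move=> cy.
have [||||f lf fE] := cf_lift F (F := fun a g b => lact a (ract (y g) b)).
- by move=> g b c x z; exact: (lact_linear_l (bimodP M)).
- by move=> a g c x z; rewrite (ract_linear_r (bimodP M)) (lact_linear_r (bimodP M)).
- by move=> a g b; rewrite lactM lractA (cy g).1.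
- by move=> a g b; rewrite ractM (cy g).2.
exists f; split; last by move=> g; rewrite fE lact1 ract1.
split=> // [a x|x b].
  apply: (cf_ext (f := fun x => f (lact a x)) (f' := fun x => lact a (f x))).
  - by move=> c u v; rewrite (lact_linear_r (bimodP P)) lf.
  - by move=> c u v; rewrite lf (lact_linear_r (bimodP M)).
  by move=> a' g b; rewrite (cell_lact C) !fE lactM.
apply: (cf_ext (f := fun x => f (ract x b)) (f' := fun x => ract (f x) b)).
- by move=> c u v; rewrite (ract_linear_l (bimodP P)) lf.
- by move=> c u v; rewrite lf (ract_linear_l (bimodP M)).
by move=> a' g b'; rewrite (cell_ract C) !fE ractM lractA.
Qed.

(** Preimages of the generators exist by surjectivity, and can be cut down to
    the corners of the generators without changing their images. *)
Lemma cf_projective : projective_bimod P.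
Proof.
move=> X Y g f hg sg hf.
pose x c := sval (cid (sg (f (t 1 c 1)))).
have xE c : g (x c) = f (t 1 c 1) by rewrite /x; case: (cid _).
have [h [hh hE]] := hom_lift (y := fun c => lact (ev (tg c)) (ract (x c) (ev (sr c))))
  (fun c => corner_proj _ _ _).
exists h; split=> //.
apply: (hom_ext (f := g \o h)) => //; first exact: hom_comp.
move=> c /=; rewrite hE; have [_ gl gr] := hg; rewrite gl gr xE.
by have [fl fr] := hom_corner hf (cell_corner C c); rewrite fr fl.
Qed.
End Free.

End CornerFree.

(** * The boundary formulas *)

(** Proves that a sum of signed terms vanishes when the terms cancel in pairs:
    the opposite of the last term is moved to the right until it meets it. *)
Ltac cancel_terms :=
  match goal with |- ?t = 0 => rewrite -[t]add0r ?addrA end;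
  repeat match goal with
  | |- ?S + ?x = 0 => first [ rewrite addrK | rewrite subrK |
      lazymatch x with
      | - ?z => match goal with |- context [?T + ?w + ?y] => unify w z; rewrite (addrAC T w y) end
      | _ => match goal with |- context [?T - ?w + ?y] => unify w x; rewrite (addrAC T (- w) y) end
      end ]
  end.

Section Words.
Variable N : nat.

(** [Cell b s i] is a word running between e_i and e_(i+1): its alternating part
    begins with p_(i+1) if [b] and with q_i otherwise, and is preceded by a loop
    if [s].  The exchange of p and q, which swaps e_i and e_(i+1), is then the
    negation of [b], and half of the formulas suffice. *)
Variant cell := Cell of bool & bool & 'I_N.

Definition letter (b : bool) (i : 'I_N) : arrow N := if b then Ap i else Aq i.
Definition endpoint (b : bool) (i : 'I_N) : 'I_N.+1 := if b then hi i else lo i.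

Lemma asrc_letter b i : asrc (letter b i) = endpoint (~~ b) i. Proof. by case: b. Qed.
Lemma atgt_letter b i : atgt (letter b i) = endpoint b i. Proof. by case: b. Qed.

Definition cell_tgt (c : cell) : 'I_N.+1 := let: Cell b _ i := c in endpoint b i.
(** The source for a word of length n > 0, whose alternating part has n - s
    letters. *)
Definition cell_src (n : nat) (c : cell) : 'I_N.+1 :=
  let: Cell b s i := c in endpoint (b (+) odd n (+) s) i.
(** A word of length 1 is an arrow: if there is a loop, nothing follows it. *)
Definition cell_arrow (c : cell) : arrow N :=
  let: Cell b s i := c in if s then As (endpoint b i) else letter b i.
End Words.

Section Boundary.
Variables (k : fieldType) (N : nat) (A : algType k).
Variables (ev : 'I_N.+1 -> A) (arr : arrow N -> A) (H : arrow_rels ev arr).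
Local Notation l b i := (arr (letter b i)).
Local Notation s b i := (arr (As (endpoint b i))).

Lemma ev_l v b i : v = endpoint b i -> ev v * l b i = l b i.
Proof. by move=> ->; rewrite (ev_arr H) atgt_letter eqxx. Qed.
Lemma l_ev v b i : v = endpoint (~~ b) i -> l b i * ev v = l b i.
Proof. by move=> ->; rewrite (arr_ev H) asrc_letter eqxx. Qed.
Lemma ev_s v b i : v = endpoint b i -> ev v * s b i = s b i.
Proof. by move=> ->; rewrite (ev_arr H) eqxx. Qed.
Lemma s_ev v b i : v = endpoint b i -> s b i * ev v = s b i.
Proof. by move=> ->; rewrite (arr_ev H) eqxx. Qed.
Lemma letterM b i : l b i * l (~~ b) i = s b i.
Proof. by case: b; [exact: (pqE H) | exact: (qpE H)]. Qed.
Lemma loop_letter b i : s b i * l b i = l b i * s (~~ b) i.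
Proof. by case: b; [exact: (spE H) | exact: (sqE H)]. Qed.

Lemma letterNM b i : l (~~ b) i * l b i = s (~~ b) i.
Proof. by rewrite -{2}[b]negbK letterM. Qed.
Lemma loop_letterN b i : s (~~ b) i * l (~~ b) i = l (~~ b) i * s b i.
Proof. by rewrite -{4}[b]negbK loop_letter. Qed.

(** The differential on a word whose degree has parity [o].  The even and the
    odd formulas differ in the sign of all terms but the first, and in the last
    letter, hence in the source, of the word. *)
Definition boundary (M : bimod A A) (E : A -> cell N -> A -> M) (o : bool) (c : cell N) : M :=
  match c with
  | Cell b false i => E 1 (Cell b false i) (l (b (+) ~~ o) i)
      + (-1) ^+ o *: (E (l b i) (Cell (~~ b) false i) 1 - E 1 (Cell b true i) 1)
  | Cell b true i => E 1 (Cell b true i) (l (b (+) o) i)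
      + (-1) ^+ o *: (E (s b i) (Cell b false i) 1 - E (l b i) (Cell (~~ b) true i) 1
                      - E 1 (Cell b false i) (s (b (+) ~~ o) i))
  end.

Lemma boundary_corner (M : bimod A A) (E : A -> cell N -> A -> M) n c :
  cells ev (@cell_tgt N) (cell_src n) E ->
  corner ev (cell_tgt c) (cell_src n.+1 c) (boundary E (odd n.+1) c).
Proof.
move=> C; case: c => b [] i /=.
- apply: cornerD; last (apply: cornerZ; apply: cornerB; first apply: cornerB); split;
  first [ rewrite (cell_lact_ev C) // | rewrite (cell_lact_ev' C) // ?ev_l ?ev_s //
     | rewrite (cell_ract_ev C) //= | rewrite (cell_ract_ev' C) // ?l_ev ?s_ev // ];
  by case: b; case: odd.
- apply: cornerD; last (apply: cornerZ; apply: cornerB); split;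
  first [ rewrite (cell_lact_ev C) // | rewrite (cell_lact_ev' C) // ?ev_l ?ev_s //
     | rewrite (cell_ract_ev C) //= | rewrite (cell_ract_ev' C) // ?l_ev ?s_ev // ];
  by case: b; case: odd.
Qed.

End Boundary.

Section BoundaryFormulas.
Variables (k : fieldType) (N : nat) (A : algType k) (arr : arrow N -> A).
Variables (M : bimod A A) (E : A -> cell N -> A -> M).
Local Notation l b i := (arr (letter b i)).
Local Notation s b i := (arr (As (endpoint b i))).

Lemma boundary_even_plain b i : boundary arr E false (Cell b false i) =
  E 1 (Cell b false i) (l (~~ b) i) + E (l b i) (Cell (~~ b) false i) 1
  - E 1 (Cell b true i) 1.
Proof. by rewrite /boundary expr0 scale1r addbT addrA. Qed.

Lemma boundary_even_loop b i : boundary arr E false (Cell b true i) =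
  E 1 (Cell b true i) (l b i) + E (s b i) (Cell b false i) 1
  - E (l b i) (Cell (~~ b) true i) 1 - E 1 (Cell b false i) (s (~~ b) i).
Proof. by rewrite /boundary expr0 scale1r addbT addbF !addrA. Qed.

Lemma boundary_odd_plain b i : boundary arr E true (Cell b false i) =
  E 1 (Cell b false i) (l b i) - E (l b i) (Cell (~~ b) false i) 1
  + E 1 (Cell b true i) 1.
Proof. by rewrite /boundary expr1 scaleN1r addbF opprD opprK addrA. Qed.

Lemma boundary_odd_loop b i : boundary arr E true (Cell b true i) =
  E 1 (Cell b true i) (l (~~ b) i) - E (s b i) (Cell b false i) 1
  + E (l b i) (Cell (~~ b) true i) 1 + E 1 (Cell b false i) (s b i).
Proof. by rewrite /boundary expr1 scaleN1r addbT addbF !opprD !opprK !addrA. Qed.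
End BoundaryFormulas.

Section Square.
Variables (k : fieldType) (N : nat) (A : algType k).
Variables (ev : 'I_N.+1 -> A) (arr : arrow N -> A) (H : arrow_rels ev arr).
Local Notation l b i := (arr (letter b i)).
Local Notation s b i := (arr (As (endpoint b i))).
Variables (M M' : bimod A A) (E : A -> cell N -> A -> M) (E' : A -> cell N -> A -> M').
Variables (tg sr tg' sr' : cell N -> 'I_N.+1).
Hypotheses (C : cells ev tg sr E) (C' : cells ev tg' sr' E').

(** After applying the relations in the algebra all terms cancel in pairs. *)
Lemma boundary_sq (o : bool) (D : M -> M') : bimod_hom D ->
  (forall c, D (E 1 c 1) = boundary arr E' o c) ->
  forall c, D (boundary arr E (~~ o) c) = 0.
Proof.
move=> hD DE; have lD := hom_lin hD.
have X a c b : D (E a c b) = lact a (ract (boundary arr E' o c) b).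
  by rewrite (hom_cell C) // DE.
have lr := (lactDr, lactNr, lactZr, ractDl, ractNl, ractZl,
             cell_lact C', cell_ract C', mul1r, mulr1).
case=> b [] i; rewrite /boundary; case: o X {DE} => X;
  rewrite /= ?expr0 ?expr1 ?scale1r ?scaleN1r ?addbT ?addbF;
  rewrite ?(linD lD, linN lD, linZ lD) !X /boundary ?lr ?addbT ?addbF /=
    ?expr0 ?expr1 ?scale1r ?scaleN1r ?negbK
    ?(loop_letterN H, loop_letter H, letterNM H, letterM H) ?opprD ?opprK;
  by cancel_terms.
Qed.

End Square.

(** * Exactness *)

Section Complex.
Variables (k : fieldType) (N : nat) (A : algType k).
Variables (ev : 'I_N.+1 -> A) (arr : arrow N -> A) (H : arrow_rels ev arr).
(** The resolution is treated for any sequence of bimodules that is free on the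
    vertices, on the arrows and, from degree 2 on, on the words.  In degree 1
    the words are arrows, and the loop at an inner vertex is a word in two ways,
    so there freeness is on the arrows, and [E0] expresses the words by them. *)
Variables (P : nat -> bimod A A).
Variables (t0 : A -> 'I_N.+1 -> A -> P 0) (t1 : A -> arrow N -> A -> P 1).
Variable E : forall n, A -> cell N -> A -> P n.+1.
Hypothesis F0 : corner_free ev id id t0.
Hypothesis F1 : corner_free ev (@atgt N) (@asrc N) t1.
Hypothesis FE : forall n, corner_free ev (@cell_tgt N) (cell_src n.+2) (E n.+1).
Hypothesis E0 : forall a c b, E 0 a c b = t1 a (cell_arrow c) b.

Local Notation l b i := (arr (letter b i)).
Local Notation s b i := (arr (As (endpoint b i))).
Let C0 := cf_cells F0.
Let C1 := cf_cells F1.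

Lemma atgt_cell c : atgt (@cell_arrow N c) = cell_tgt c.
Proof. by case: c => [[] [] i]. Qed.
Lemma asrc_cell c : asrc (@cell_arrow N c) = cell_src 1 c.
Proof. by case: c => [[] [] i]. Qed.

Lemma E_cells n : cells ev (@cell_tgt N) (cell_src n.+1) (E n).
Proof.
case: n => [|n]; last exact: cf_cells (FE n).
split=> [c b|a c|a c b|a c b|d a c b|a c b d].
- by move=> e x y; rewrite !E0; apply: (cell_linl C1).
- by move=> e x y; rewrite !E0; apply: (cell_linr C1).
- by rewrite !E0 -atgt_cell (cell_evl C1).
- by rewrite !E0 -asrc_cell (cell_evr C1).
- by rewrite !E0 (cell_lact C1).
- by rewrite !E0 (cell_ract C1).
Qed.

(** The tensor 1 (x) 1. *)
Definition unit_tensor : P 0 := \sum_v t0 1 v 1.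

Lemma lact_unit_tensor v : lact (ev v) unit_tensor = t0 1 v 1.
Proof.
rewrite /unit_tensor lact_sumr (bigD1 v) // big1 /= ?addr0 => [|u nu].
  by rewrite (cell_lact_ev C0).
rewrite (cell_lact C0) mulr1 -(cell_evl C0) (evM H) eq_sym (negPf nu).
exact: (lin0 (cell_linl C0 u 1)).
Qed.

Lemma ract_unit_tensor v : ract unit_tensor (ev v) = t0 1 v 1.
Proof.
rewrite /unit_tensor ract_suml (bigD1 v) // big1 /= ?addr0 => [|u nu].
  by rewrite (cell_ract_ev C0).
rewrite (cell_ract C0) mul1r -(cell_evr C0) (evM H) (negPf nu).
exact: (lin0 (cell_linr C0 1 u)).
Qed.

Lemma vertex_cellE a v b : t0 a v b = lact a (ract unit_tensor (ev v * b)).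
Proof. by rewrite (cell_decomp C0) ractM ract_unit_tensor. Qed.

Record cell_differential (eps : P 0 -> diagbimod A)
    (d : forall n, P n.+1 -> P n) : Prop := CellDifferential {
  ceps_hom : bimod_hom eps;
  cd_hom : forall n, bimod_hom (d n);
  ceps_unit : eps unit_tensor = 1 :> A;
  cd0 : forall w, d 0%N (t1 1 w 1) = ract unit_tensor (arr w) - lact (arr w) unit_tensor;
  cdS : forall n c, d n.+1 (E n.+1 1 c 1) = boundary arr (E n) (odd n.+2) c
}.

Lemma d0_corner w :
  corner ev (atgt w) (asrc w) (ract unit_tensor (arr w) - lact (arr w) unit_tensor).
Proof.
split; rewrite ?lactBr ?ractBl.
  rewrite lractA lact_unit_tensor -ract_unit_tensor -ractM -lactM.
  by rewrite !(ev_arr H) !eqxx.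
rewrite -lractA ract_unit_tensor -lact_unit_tensor -ractM -lactM.
by rewrite !(arr_ev H) !eqxx.
Qed.

Lemma cell_differential_exists : exists eps d, cell_differential eps d.
Proof.
have [|eps [heps epsE]] := hom_lift F0 (M := diagbimod A) (y := ev).
  by move=> v; split; rewrite /= (evM H) eqxx.
have spec n : exists f : P n.+1 -> P n, bimod_hom f /\
    match n return (P n.+1 -> P n) -> Prop with
    | 0 => fun f => forall w, f (t1 1 w 1) = ract unit_tensor (arr w) - lact (arr w) unit_tensor
    | m.+1 => fun f => forall c, f (E m.+1 1 c 1) = boundary arr (E m) (odd m.+2) c
    end f.
  case: n => [|n]; first exact: (hom_lift F1 d0_corner).
  by apply: (hom_lift (FE n)) => c; apply: (boundary_corner H); apply: E_cells.
exists eps, (fun n => sval (cid (spec n))); split=> // [n||w|n c].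
- by case: (cid _) => f [].
- rewrite /unit_tensor (lin_sum (hom_lin heps)); apply: etrans (sum_ev H).
  by apply: eq_bigr => v _; rewrite epsE.
- by case: (cid _) => f [? fE] /=.
- by case: (cid _) => f [? fE] /=.
Qed.

Section Exactness.
Variables (eps : P 0 -> diagbimod A) (d : forall n, P n.+1 -> P n).
Arguments d : clear implicits.
Hypothesis D : cell_differential eps d.
Let he := ceps_hom D.
Let hd n := cd_hom D n.

Lemma cell_differential_uniq eps' d' : cell_differential eps' d' ->
  (forall x, eps' x = eps x) /\ (forall n x, d' n x = d n x).
Proof.
move=> D'; have he' := ceps_hom D'; split=> [|n].
  apply: (hom_ext F0 he' he) => v; rewrite -lact_unit_tensor.
  have [_ e1 _] := he; have [_ e1' _] := he'.
  by rewrite e1 e1' (ceps_unit D) (ceps_unit D').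
have h' := cd_hom D' n; have h := hd n; case: n h h' => [|n] h h'.
  by apply: (hom_ext F1 h' h) => w; rewrite (cd0 D) (cd0 D').
by apply: (hom_ext (FE n) h' h) => c; rewrite (cdS D) (cdS D').
Qed.

Lemma P_projective n : projective_bimod (P n).
Proof.
case: n => [|[|n]]; first exact: (cf_projective (evM H) F0).
  exact: (cf_projective (evM H) F1).
exact: (cf_projective (evM H) (FE n)).
Qed.

Lemma eps_d0 x : eps (d 0 x) = 0.
Proof.
apply: (hom_ext F1 (hom_comp he (hd 0)) (hom_cst0 _ _)) => w /=.
have [le e1 e2] := he.
by rewrite (cd0 D) (linB le) e1 e2 (ceps_unit D) /= mulr1 mul1r subrr.
Qed.

Lemma d0_d1 x : d 0 (d 1 x) = 0.
Proof.
apply: (hom_ext (FE 0) (hom_comp (hd 0) (hd 1)) (hom_cst0 _ _)) => c /=.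
have h0 := hd 0; have l0 := hom_lin h0.
have X a w b : d 0 (t1 a w b) =
    lact a (ract unit_tensor (arr w * b)) - lact (a * arr w) (ract unit_tensor b).
  by rewrite (hom_cell C1) // (cd0 D) ractBl lactBr -ractM -lractA lactM.
rewrite (cdS D) /boundary.
case: c => b [] i; rewrite !E0 /= expr0 scale1r ?addbT ?addbF
  ?(linD l0, linN l0) !X ?mul1r ?mulr1 ?lact1 ?ract1 -?(loop_letter H) -?(letterM H) ?opprD ?opprK;
  by cancel_terms.
Qed.

Lemma d_d n x : d n (d n.+1 x) = 0.
Proof.
case: n x => [|n] x; first exact: d0_d1.
apply: (hom_ext (FE n.+1) (hom_comp (hd n.+1) (hd n.+2)) (hom_cst0 _ _)) => c /=.
rewrite (cdS D); have -> : odd n.+3 = ~~ odd n.+2 by [].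
by apply: (boundary_sq H (E_cells n.+1) (E_cells n) (hd n.+1)) => c'; rewrite (cdS D).
Qed.

Hypothesis indA : forall Q : A -> Prop, Q 0 ->
  (forall c x y, Q x -> Q y -> Q (c *: x + y)) -> (forall v, Q (ev v)) ->
  (forall a x, Q x -> Q (arr a * x)) -> forall x, Q x.
Hypothesis retrA : forall v, exists f : A -> A, linear f /\
  forall b, f (arr (Aq v) * b) = ev (hi v) * b.
Hypothesis derA : forall (M : bimod A A) (m : arrow N -> M) (U : M -> Prop),
  subbimod U -> (forall a, lact (ev (atgt a)) (m a) = m a) ->
  (forall a, ract (m a) (ev (asrc a)) = m a) -> leibniz_rels arr m U ->
  exists2 D : A -> M, linear D &
  forall a x, U (D (arr a * x) - (lact (arr a) (D x) + ract (m a) x)).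

Lemma eps_surj y : exists x, eps x = y.
Proof.
exists (lact y unit_tensor); have [_ e1 _] := he.
by rewrite e1 (ceps_unit D); apply: mulr1.
Qed.

(** By telescoping: b (x) 1 turns into 1 (x) b when the arrows of b are moved
    one by one across the tensor sign, each step costing a boundary. *)
Lemma unit_tensor_comm b : exists y, d 0 y = ract unit_tensor b - lact b unit_tensor.
Proof.
have HU := hom_image_sub (hd 0); elim/indA: b => [|c x y Ux Uy|v|a x Ux].
- by rewrite ract0r lact0l subrr; apply: (subbimod0 HU).
- rewrite ractDr ractZr lactDl lactZl opprD addrACA -scalerBr.
  exact: (subbimodP HU).
- by rewrite ract_unit_tensor lact_unit_tensor subrr; apply: (subbimod0 HU).
have -> : ract unit_tensor (arr a * x) - lact (arr a * x) unit_tensor =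
    ract (ract unit_tensor (arr a) - lact (arr a) unit_tensor) x
    + lact (arr a) (ract unit_tensor x - lact x unit_tensor).
  by rewrite ractBl lactBr -ractM -lactM lractA addrA subrK.
apply: (subbimodD HU); last exact: (subbimod_lact HU).
by apply: (subbimod_ract HU); exists (t1 1 a 1); rewrite (cd0 D).
Qed.

(** Modulo boundaries, a (x) b is the product a b times 1 (x) 1. *)
Lemma exact_P0 x : eps x = 0 -> exists y, d 0 y = x.
Proof.
have HU := hom_image_sub (hd 0); have [le e1 e2] := he.
suff U : exists y, d 0 y = x - lact (eps x) unit_tensor.
  by move=> ex; move: U; rewrite ex lact0l subr0.
elim/(cf_ind F0): x => [|a v b x Ux].
  by rewrite (lin0 le) lact0l subr0; apply: (subbimod0 HU).
rewrite (linD le) lactDl opprD addrACA; apply: (subbimodD HU) => //.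
rewrite vertex_cellE e1 e2 (ceps_unit D).
have -> : lact a (ract (1 : diagbimod A) (ev v * b)) = a * (ev v * b) :> A.
  by rewrite /= mul1r.
by rewrite lactM -lactBr; apply: (subbimod_lact HU); apply: unit_tensor_comm.
Qed.

(** If B is the universal derivation modulo boundaries, h : a (x) b |-> a B(b)
    maps a (x) w b - a w (x) b to a (B(w b) - w B(b)), which is a (x) w (x) b
    modulo boundaries: h d is the identity of P_1 modulo boundaries. *)
Lemma exact_P1 x : d 0 x = 0 -> exists y, d 1 y = x.
Proof.
have HU := hom_image_sub (hd 1).
set U := fun y : P 1 => exists x, d 1 x = y in HU *.
have ml a : lact (ev (atgt a)) (t1 1 a 1) = t1 1 a 1 by rewrite (cell_lact_ev C1).
have mr a : ract (t1 1 a 1) (ev (asrc a)) = t1 1 a 1 by rewrite (cell_ract_ev C1).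
have R : leibniz_rels arr (fun a => t1 1 a 1) U.
  move=> i; rewrite !(cell_lact C1) !(cell_ract C1) !mul1r !mulr1.
  split.
  - exists (E 1 1 (Cell false false i) 1); rewrite (cdS D) /= expr0 scale1r !E0 /=.
    by rewrite addrA [X in X - _]addrC.
  - exists (E 1 1 (Cell true false i) 1); rewrite (cdS D) /= expr0 scale1r !E0 /=.
    by rewrite addrA [X in X - _]addrC.
  - exists (E 1 1 (Cell true true i) 1); rewrite (cdS D) /= expr0 scale1r !E0 /=.
    by rewrite !addrA opprD addrA [X in X - _ - _]addrC.
  - exists (E 1 1 (Cell false true i) 1); rewrite (cdS D) /= expr0 scale1r !E0 /=.
    by rewrite !addrA opprD addrA [X in X - _ - _]addrC.
have [B lB BE] := derA HU ml mr R.
have [|||| h lh hE] := cf_lift F0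
   (* The idempotents make the map balanced exactly, not only modulo [U]. *)
   (F := fun a v b => lact (a * ev v) (B (ev v * b))).
- move=> v b c a a'; rewrite mulrDl -scalerAl.
  exact: (lact_linear_l (bimodP (P 1))).
- by move=> a v c b b'; rewrite mulrDr -scalerAr lB (lact_linear_r (bimodP (P 1))).
- by move=> a v b; rewrite -(mulrA a) (evM H) eqxx.
- by move=> a v b; rewrite (mulrA (ev v)) (evM H) eqxx.
have l0 := hom_lin (hd 0).
suff hU z : U (h (d 0 z) - z).
  move=> dx; have := hU x; rewrite dx (lin0 lh) sub0r => Ux.
  by rewrite -[x]opprK; apply: (subbimodN HU).
elim/(cf_ind F1): z => [|a w b z Uz].
  by rewrite (lin0 l0) (lin0 lh) subrr; apply: (subbimod0 HU).
rewrite (linD l0) (linD lh) opprD addrACA; apply: (subbimodD HU) => //.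
rewrite -(cell_evr C1); set b' := ev (asrc w) * b.
have -> : d 0 (t1 a w b') = t0 a (atgt w) (arr w * b') - t0 (a * arr w) (asrc w) b'.
  rewrite (hom_cell C1) // (cd0 D) ractBl lactBr -ractM -(lractA (arr w)) -lactM.
  by rewrite !vertex_cellE (mulrA (ev (atgt w))) (ev_arr H) eqxx /b' (mulrA (ev _)) (evM H) eqxx.
rewrite (linB lh) !hE.
have -> : ev (asrc w) * b' = b' by rewrite /b' mulrA (evM H) eqxx.
rewrite -(mulrA a) (arr_ev H) eqxx mulrA (ev_arr H) eqxx.
have -> : t1 a w b' = lact (a * ev (atgt w)) (ract (t1 1 w 1) b').
  by rewrite (cell_ract C1) (cell_lact C1) mul1r mulr1 (cell_evl C1).
have -> : lact (a * arr w) (B b') = lact (a * ev (atgt w)) (lact (arr w) (B b')).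
  by rewrite -lactM -mulrA (ev_arr H) eqxx.
rewrite -!lactBr -addrA -opprD; apply: (subbimod_lact HU); exact: BE.
Qed.

(** In degree n + 2 the boundary of the plain word of degree n + 3 contains the
    looped word with coefficient -(-1)^(n+3) = (-1)^n; the map inverts this part
    of the differential. *)
Lemma partial_contraction n : exists h : P n.+2 -> P n.+3, bimod_hom h /\
  forall b s i, h (E n.+1 1 (Cell b s i) 1) =
    if s then (-1) ^+ odd n *: E n.+2 1 (Cell b false i) 1 else 0.
Proof.
have [c|h [hh hE]] := hom_lift (FE n) (M := P n.+3)
  (y := fun c => let: Cell b s i := c in
     if s then (-1) ^+ odd n *: E n.+2 1 (Cell b false i) 1 else 0).
  case: c => b [] i; last exact: corner0.
  apply: cornerZ.
  have -> : cell_src n.+2 (Cell b true i) = cell_src n.+3 (Cell b false i).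
    by rewrite /=; case: (odd n); case: b.
  exact: cell_corner (E_cells n.+2) (Cell b false i).
by exists h; split=> // b s i; apply: hE.
Qed.

(** The partial inverses of the differential form a contracting homotopy. *)
Lemma exact_P_ge3 n x : d n.+2 x = 0 -> exists y, d n.+3 y = x.
Proof.
have [h [hh hE]] := partial_contraction n.
have [h' [hh' hE']] := partial_contraction n.+1.
have lh := hom_lin hh; have l3 := hom_lin (hd n.+3).
have X a b t i c : h (E n.+1 a (Cell b t i) c) =
    if t then (-1) ^+ odd n *: E n.+2 a (Cell b false i) c else 0.
  rewrite (hom_cell (E_cells n.+1)) // hE; case: t; last by rewrite ract0l lact0r.
  by rewrite ractZl lactZr (cell_ract (E_cells n.+2)) (cell_lact (E_cells n.+2)) mul1r mulr1.
have key z : h (d n.+2 z) + d n.+3 (h' z) = z.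
  apply: (hom_ext (FE n.+1)
            (hom_add (hom_comp hh (hd n.+2)) (hom_comp (hd n.+3) hh')) (hom_id _)).
  move=> [b t i] /=; rewrite (cdS D) hE' /=.
  apply/eqP; rewrite -subr_eq0; apply/eqP.
  case: t; rewrite ?(lin0 l3) ?(linZ l3) ?(cdS D) /=; case: (odd n) X => /= X;
    rewrite ?expr0 ?expr1 ?scale1r ?scaleN1r ?addbT ?addbF
     ?(linD lh, linN lh, linZ lh) !X ?scale1r ?scaleN1r /=
     ?subr0 ?add0r ?addr0 ?oppr0 ?opprD ?opprK ?expr0 ?expr1 ?scale1r ?scaleN1r ?negbK;
   by cancel_terms.
move=> dx; exists (h' x); rewrite -[RHS]key dx (lin0 lh) add0r; reflexivity.
Qed.

Lemma plain_proj_exists b i : exists pr : P 2 -> P 2, bimod_hom pr /\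
  forall x b' t i' y, pr (E 1 x (Cell b' t i') y) =
    if [&& b' == b, ~~ t & i' == i] then E 1 x (Cell b false i) y else 0.
Proof.
have [c|pr [hp pE]] := hom_lift (FE 0) (M := P 2)
  (y := fun c => let: Cell b' t i' := c in
     if [&& b' == b, ~~ t & i' == i] then E 1 1 (Cell b false i) 1 else 0).
  case: c => b' t i'; apply: corner_if => /and3P[/eqP-> tF /eqP->].
  by rewrite (negPf tF); exact: cell_corner (E_cells 1) _.
exists pr; split=> // x b' t i' y; rewrite (hom_cell (E_cells 1)) // pE.
case: ifP => _; last by rewrite ract0l lact0r.
by rewrite (cell_ract (E_cells 1)) (cell_lact (E_cells 1)) mul1r mulr1.
Qed.

Definition plain_proj b i : P 2 -> P 2 := sval (cid (plain_proj_exists b i)).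
Lemma plain_proj_hom b i : bimod_hom (plain_proj b i).
Proof. by rewrite /plain_proj; case: (cid _) => f []. Qed.
Lemma plain_projE b i x b' t i' y : plain_proj b i (E 1 x (Cell b' t i') y) =
  if [&& b' == b, ~~ t & i' == i] then E 1 x (Cell b false i) y else 0.
Proof. by rewrite /plain_proj; case: (cid _) => f [? fE]. Qed.

Lemma d1E x b t i y : d 1 (E 1 x (Cell b t i) y) =
  lact x (ract (boundary arr (E 0) false (Cell b t i)) y).
Proof. by rewrite (hom_cell (E_cells 1)) // (cdS D). Qed.

Lemma d1_plain x b i y : d 1 (E 1 x (Cell b false i) y) =
  t1 x (letter b i) (l (~~ b) i * y) + t1 (x * l b i) (letter (~~ b) i) y
  - t1 x (As (endpoint b i)) y.
Proof.
rewrite d1E /boundary !E0 /= expr0 scale1r addbT !ractDl !ractNl !lactDr !lactNr.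
by rewrite !(cell_ract C1) !(cell_lact C1) !mul1r !mulr1 addrA.
Qed.

(** The coefficient at the loop of e_i of an element of P_1, written as a
    multiple of the word Q^2_i, which is a loop at e_i as well. *)
Lemma loop_component i : exists r : P 1 -> P 2, bimod_hom r /\
  forall x a y, r (t1 x a y) = if a == As (lo i) then E 1 x (Cell false false i) y else 0.
Proof.
have [a|r [hr rE]] := hom_lift F1 (M := P 2)
  (y := fun a => if a == As (lo i) then E 1 1 (Cell false false i) 1 else 0).
  by apply: corner_if => /eqP->; exact: cell_corner (E_cells 1) (Cell false false i).
exists r; split=> // x a y; rewrite (hom_cell C1) // rE.
case: ifP => _; last by rewrite ract0l lact0r.
by rewrite (cell_ract (E_cells 1)) (cell_lact (E_cells 1)) mul1r mulr1.
Qed.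

(** The coefficient at p_(i+1) of an element of P_1, with q_i cancelled in its
    right factor and written as a multiple of the word P^2_(i+1). *)
Lemma p_component i : exists r : P 1 -> P 2, linear r /\
  (forall x a y, a != Ap i -> r (t1 x a y) = 0) /\
  (forall x y, r (t1 x (Ap i) (arr (Aq i) * y)) = E 1 x (Cell true false i) y).
Proof.
have [f [lf fE]] := retrA i.
have [||||r lr rE] := cf_lift F1 (F := fun x a y =>
   if a == Ap i then E 1 (x * ev (hi i)) (Cell true false i) (f (ev (lo i) * y)) else 0).
- move=> a y c u v; case: ifP => _; last by rewrite scaler0 addr0.
  by rewrite mulrDl -scalerAl (cell_linl (E_cells 1)).
- move=> x a c u v; case: ifP => _; last by rewrite scaler0 addr0.
  by rewrite mulrDr -scalerAr lf (cell_linr (E_cells 1)).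
- move=> x a y; case: eqP => // ->.
  by rewrite -(mulrA x) (evM H) eqxx.
- move=> x a y; case: eqP => // ->.
  by rewrite mulrA (evM H) eqxx.
exists r; split=> //; split=> [x a y na|x y]; rewrite rE ?(negPf na) // eqxx.
rewrite mulrA (ev_arr H) eqxx fE.
by rewrite -[RHS](cell_evr (E_cells 1)) -[RHS](cell_evl (E_cells 1)).
Qed.

(** A cycle is moved by a boundary into the span of the plain words, where
    the differential is injective: induction on the vertices along the quiver,
    using that among the plain words the loop at e_i occurs only in the
    boundaries of Q^2_i and P^2_i, and p_(i+1) as the middle factor only in
    those of Q^2_i and P^2_(i+1). *)
Lemma exact_P2 x : d 1 x = 0 -> exists y, d 2 y = x.
Proof.
move=> dx; have [h [hh hE]] := partial_contraction 0.
have lh := hom_lin hh; have l1 := hom_lin (hd 1); have l2 := hom_lin (hd 2).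
pose z := x - d 2 (h x).
suff z0 : z = 0 by exists (h x); apply/eqP; rewrite eq_sym -subr_eq0; apply/eqP.
have dz : d 1 z = 0 by rewrite (linB l1) dx d_d subrr.
have sp b i := hom_lin (plain_proj_hom b i).
(* The corrected element has no looped component, whatever [u] is. *)
have TE u : u - d 2 (h u) =
    \sum_i (plain_proj false i (u - d 2 (h u)) + plain_proj true i (u - d 2 (h u))).
  have h2 := hom_sub (hom_id _) (hom_comp (hd 2) hh).
  apply: (cf_ext (FE 0) (f := fun u => u - d 2 (h u))
    (f' := fun u => \sum_i (plain_proj false i (u - d 2 (h u)) + plain_proj true i (u - d 2 (h u))))).
  - exact: hom_lin h2.
  - move=> c v w; rewrite scaler_sumr -big_split; apply: eq_bigr => i _ /=.
    by rewrite (hom_lin h2) !sp scalerDr addrACA.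
  have sumE v b i w : \sum_j (plain_proj false j (E 1 v (Cell b false i) w)
      + plain_proj true j (E 1 v (Cell b false i) w)) = E 1 v (Cell b false i) w.
    rewrite (bigD1 i) // big1 /= => [|j nj]; rewrite !plain_projE ?eqxx /=.
      by case: b; rewrite ?add0r !addr0.
    by rewrite [i == j]eq_sym (negPf nj) !andbF addr0.
  move=> v [b t i] w; rewrite (hom_cell (E_cells 1) _ _ _ hh) hE.
  case: t; last by rewrite ract0l lact0r (lin0 l2) subr0 sumE.
  rewrite expr0 scale1r (cell_ract (E_cells 2)) (cell_lact (E_cells 2)) mul1r mulr1.
  rewrite (hom_cell (E_cells 2)) // (cdS D) /boundary /= expr1 scaleN1r.
  rewrite addbF opprD opprK !(ractDl, lactDr, ractNl, lactNr).
  rewrite !(cell_ract (E_cells 1)) !(cell_lact (E_cells 1)) !mul1r !mulr1.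
  set X := E 1 _ (Cell b true i) _; set Y := E 1 _ (Cell (~~ b) _ _) _.
  set Z := E 1 _ (Cell b false _) _.
  have -> : X - (Z + (- Y + X)) = Y - Z.
    by rewrite [Z + _]addrA [_ + X]addrC opprD addrA subrr add0r opprB.
  rewrite (eq_bigr (fun j => (plain_proj false j Y + plain_proj true j Y)
    - (plain_proj false j Z + plain_proj true j Z))).
    by rewrite sumrB !sumE.
  by move=> j _; rewrite !(linB (sp _ _)) addrACA -opprD.
have zE : z = \sum_i (plain_proj false i z + plain_proj true i z) := TE x.
suff pz n (i : 'I_N) : (i < n)%N -> plain_proj false i z = 0 /\ plain_proj true i z = 0.
  by rewrite zE big1 // => i _; have [-> ->] := pz _ i (ltn_ord i); rewrite addr0.
elim: n i => // n IH i; rewrite ltnS leq_eqVlt => /orP[/eqP ni|]; last exact: IH.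
have sumd (V : lmodType k) (r : P 1 -> V) : linear r ->
    0 = \sum_j (r (d 1 (plain_proj false j z)) + r (d 1 (plain_proj true j z))).
  move=> lr; have e : r (d 1 z) = 0 by rewrite dz (lin0 lr).
  rewrite -[LHS]e {1}zE (lin_sum l1) (lin_sum lr).
  by apply: eq_bigr => j _; rewrite (linD l1) (linD lr).
(* Identities between maps on a summand are tested on its generator. *)
have prx (V : lmodType k) (r : P 1 -> V) (e : P 2 -> V) b j : linear r -> linear e ->
    (forall u w, r (d 1 (E 1 u (Cell b false j) w)) = e (E 1 u (Cell b false j) w)) ->
    forall u, r (d 1 (plain_proj b j u)) = e (plain_proj b j u).
  move=> lr le re; apply: (cf_ext (FE 0)).
  - by move=> c u v; rewrite sp l1 lr.
  - by move=> c u v; rewrite sp le.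
  move=> u [b' t j'] v; rewrite plain_projE; case: ifP => _; last first.
    by rewrite (lin0 l1) (lin0 lr) (lin0 le).
  exact: re.
have q0 : plain_proj false i z = 0.
  have [r [hr rE]] := loop_component i; have lr := hom_lin hr.
  have e0 j : r (d 1 (plain_proj true j z)) = 0.
    (* [hi j = lo i] means that j + 1 = i: the word P^2_i of the step before. *)
    case: (eqVneq (hi j) (lo i)) => [e|ne].
      have ji : (j < n)%N by rewrite -ni -[i : nat]/(lo i : nat) -e.
      by have [_ ->] := IH j ji; rewrite (lin0 l1) (lin0 lr).
    apply: (prx _ r (fun=> 0)) => //; first exact: lin_cst0.
    move=> u w; rewrite d1_plain !(linD lr) (linN lr) !rE /=.
    have /negPf-> : As (hi j) != As (lo i) by apply: contra ne => /eqP/(congr1 (@asrc N))/eqP.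
    by rewrite subr0 addr0.
  have e1 j : r (d 1 (plain_proj false j z)) = if j == i then - plain_proj false i z else 0.
    case: (eqVneq j i) => [->|ne].
      apply: (prx _ r (fun u => - u)) => //.
        by move=> c u v; rewrite opprD scalerN.
      move=> u w; rewrite d1_plain !(linD lr) (linN lr) !rE /= eqxx.
      by rewrite !add0r.
    apply: (prx _ r (fun=> 0)) => //; first exact: lin_cst0.
    move=> u w; rewrite d1_plain !(linD lr) (linN lr) !rE /=.
    have /negPf-> : As (lo j) != As (lo i).
      by apply: contra ne => /eqP/(congr1 (@asrc N))/lo_inj/eqP.
    by rewrite subr0 addr0.
  have := sumd _ r lr; rewrite (bigD1 i) // big1 /= => [|j nj]; rewrite e0 e1.
    by rewrite eqxx !addr0 => /eqP; rewrite eq_sym oppr_eq0 => /eqP.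
  by rewrite (negPf nj) addr0.
split=> //; have [r [lr [rE0 rE1]]] := p_component i.
have e0 j : r (d 1 (plain_proj false j z)) = 0.
  case: (eqVneq j i) => [->|ne]; first by rewrite q0 (lin0 l1) (lin0 lr).
  apply: (prx _ r (fun=> 0)) => //; first exact: lin_cst0.
  move=> u w; rewrite d1_plain !(linD lr) (linN lr).
  have nj : Ap j != Ap i by apply: contra ne => /eqP/(congr1 (@asrc N))/lo_inj/eqP.
  by rewrite !rE0 ?subr0 ?addr0.
have e1 j : r (d 1 (plain_proj true j z)) = if j == i then plain_proj true i z else 0.
  case: (eqVneq j i) => [->|ne].
    apply: (prx _ r id) => // u w.
    by rewrite d1_plain !(linD lr) (linN lr) rE1 !rE0 ?subr0 ?addr0.
  apply: (prx _ r (fun=> 0)) => //; first exact: lin_cst0.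
  move=> u w; rewrite d1_plain !(linD lr) (linN lr).
  have nj : Ap j != Ap i by apply: contra ne => /eqP/(congr1 (@asrc N))/lo_inj/eqP.
  by rewrite !rE0 ?subr0 ?addr0.
have := sumd _ r lr; rewrite (bigD1 i) // big1 /= => [|j nj]; rewrite e0 e1.
  by rewrite eqxx add0r addr0.
by rewrite (negPf nj) addr0.
Qed.

Lemma cell_resolution : projective_resolution eps d.
Proof.
split; first by split; [exact: he | exact: hd].
- exact: P_projective.
- exact: eps_surj.
- by move=> x; split; [exact: exact_P0 | case=> y <-; exact: eps_d0].
move=> n x; split; last by case=> y <-; exact: d_d.
case: n x => [|[|n]] x; [exact: exact_P1 | exact: exact_P2 | exact: exact_P_ge3].
Qed.

End Exactness.
End Complex.

(** * The bimodules P_n *)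

Section Concrete.
Variables (k : fieldType) (N : nat).
Local Notation A := (algA k N).
Local Notation ev := (@ev k N).
Local Notation arrA := (@arr_A k N).

(** As a (x) b is the sum of the a e_v (x) b, the bimodule P_0 is free on the
    vertices. *)
Definition vertex_cell (a : A) (v : 'I_N.+1) (b : A) : Pbm k N 0 := tens2 (a * ev v) b.

Lemma tens2_bal (a b : A) c : tens2 (a * vert_A k N c) b = tens2 a (vert_A k N c * b).
Proof. exact: (@tens_bal k A (kQ0 k N) A (A_r k N) (A_l k N) a c b). Qed.
Lemma tens2_linl (b : A) : linear (fun a => tens2 a b).
Proof.
move=> c x y; rewrite -(@tensZl k A (kQ0 k N) A (A_r k N) (A_l k N)).
exact: (@tensDl k A (kQ0 k N) A (A_r k N) (A_l k N)).
Qed.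
Lemma tens2_linr (a : A) : linear (tens2 a).
Proof.
move=> c x y; rewrite -(@tensZr k A (kQ0 k N) A (A_r k N) (A_l k N)).
exact: (@tensDr k A (kQ0 k N) A (A_r k N) (A_l k N)).
Qed.
Lemma lact_tens2 (c a b : A) : lact c (tens2 a b) = tens2 (c * a) b.
Proof. exact: (@tensor_lact_tens k A (kQ0 k N) A (A_r k N) (A_l k N)). Qed.
Lemma ract_tens2 (c a b : A) : ract (tens2 a b) c = tens2 a (b * c).
Proof. exact: (@tensor_ract_tens k A (kQ0 k N) A (A_r k N) (A_l k N)). Qed.
Lemma tens2_ind (Q : Pbm k N 0 -> Prop) : Q 0 ->
  (forall a b x, Q x -> Q (tens2 a b + x)) -> forall x, Q x.
Proof. exact: (@tens_ind k A (kQ0 k N) A (A_r k N) (A_l k N)). Qed.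
Lemma tens2_lift (W : lmodType k) (f : A -> A -> W) :
  (forall b, linear (fun a => f a b)) -> (forall a, linear (f a)) ->
  (forall a c b, f (a * vert_A k N c) b = f a (vert_A k N c * b)) ->
  exists2 g : Pbm k N 0 -> W, linear g & forall a b, g (tens2 a b) = f a b.
Proof.
move=> fl fr fb.
have [g lg gE] := @tensor_lift k A (kQ0 k N) A (A_r k N) (A_l k N) W f fl fr fb.
by exists g.
Qed.

Lemma tens2_free : corner_free ev id id vertex_cell.
Proof.
split; first split.
- by move=> v b c x y; rewrite /vertex_cell mulrDl -scalerAl (tens2_linl b).
- by move=> a v; apply: tens2_linr.
- by move=> a v b; rewrite /vertex_cell -(mulrA a) (evM (algA_rels k N)) eqxx.
- move=> a v b; rewrite /vertex_cell -tens2_bal -(mulrA a).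
  by rewrite (evM (algA_rels k N)) eqxx.
- by move=> c a v b; rewrite /vertex_cell lact_tens2 mulrA.
- by move=> a v b c; rewrite /vertex_cell ract_tens2.
- move=> Q Q0 QS; apply: tens2_ind => // a b x Qx.
  have -> : tens2 a b = \sum_v vertex_cell a v b.
    rewrite -(lin_sum (tens2_linl b)) -mulr_sumr (sum_ev (algA_rels k N)).
    by rewrite mulr1.
  by elim/big_rec: _ x Qx => [|v y _ IH] x Qx; rewrite ?add0r // -addrA; apply/QS/IH.
move=> V F Fl Fr Fel Fer.
have sumV (I : finType) (f g : I -> V) c :
    \sum_i (c *: f i + g i) = c *: (\sum_i f i) + \sum_i g i.
  by rewrite big_split scaler_sumr.
have [||| g lg gE] := @tens2_lift V (fun a b => \sum_v F a v b).
- by move=> b c x y; rewrite -sumV; apply: eq_bigr => v _; apply: Fl.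
- by move=> a c x y; rewrite -sumV; apply: eq_bigr => v _; apply: Fr.
- move=> a c b; apply: eq_bigr => v _.
  rewrite -Fel -(mulrA a) ev_vert -scalerAr (linZ (Fl v b)) Fel.
  by rewrite -[RHS]Fer (mulrA (ev v)) vert_ev -scalerAl (linZ (Fr a v)) Fer.
exists g => // a v b; rewrite /vertex_cell gE (bigD1 v) // big1 /= => [|u nu].
  by rewrite addr0 (Fel a v b).
rewrite -(Fel _ u) -(mulrA a) (evM (algA_rels k N)) eq_sym (negPf nu) mulr0.
exact: lin0 (Fl u b).
Qed.

Lemma vertex_cell_unit : unit_tensor vertex_cell = tens2 1 1.
Proof.
rewrite /unit_tensor -(lin_sum (tens2_linl 1) _ (fun v => 1 * ev v)) -mulr_sumr.
by rewrite (sum_ev (algA_rels k N)) mulr1.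
Qed.

Section Tens3.
Variable n : nat.
Local Notation S := (kS k N n.+1).
Local Notation elt := (kS_elt k n.+1).
Local Notation t3 := (@tens3 k N n).
Local Notation AS := (tensor (A_r k N) S).

Lemma kS_elt_l (w : qpath (Qx N)) : lact (vdelta k (ptgt w)) (elt w) = elt w.
Proof.
apply/ffunP => u; rewrite !ffunE; case: (eqVneq (ssval u) w) => [->|_]; last by rewrite mulr0.
by rewrite eqxx mul1r.
Qed.
Lemma kS_elt_r (w : qpath (Qx N)) : ract (elt w) (vdelta k (psrc w)) = elt w.
Proof.
apply/ffunP => u; rewrite !ffunE; case: (eqVneq (ssval u) w) => [->|_]; last by rewrite mul0r.
by rewrite eqxx mul1r.
Qed.
Lemma kS_sum (f : S) : f = \sum_u f u *: elt (ssval u).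
Proof.
apply/ffunP => u; transitivity (\sum_v (f v : k) * (u == v)%:R).
  rewrite (bigD1 u) // big1 /= ?eqxx ?mulr1 ?addr0 // => v nv.
  by rewrite eq_sym (negPf nv) mulr0.
rewrite sum_ffunE; apply: eq_bigr => v _; rewrite !ffunE; congr (_ * _%:R).
Qed.

Lemma tens3_linl w b : linear (fun a => t3 a w b).
Proof.
exact: lin_comp (@tens_linl _ _ _ _ AS (A_l k N) b)
                (@tens_linl _ _ _ _ (A_r k N) S (elt w)).
Qed.
Lemma tens3_linr a w : linear (t3 a w).
Proof. exact: (@tens_linr _ _ _ _ AS (A_l k N)). Qed.
Lemma tens3_evl a (w : qpath (Qx N)) b : t3 (a * ev (ptgt w)) w b = t3 a w b.
Proof.
rewrite /tens3; congr (tens _ _).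
transitivity (@tens _ _ _ _ (A_r k N) S a (lact (vdelta k (ptgt w)) (elt w))).
  exact: (@tens_bal _ _ _ _ (A_r k N) S).
by rewrite kS_elt_l.
Qed.
Lemma tens3_evr a (w : qpath (Qx N)) b : t3 a w (ev (psrc w) * b) = t3 a w b.
Proof.
rewrite /tens3 -(@tens_bal _ _ _ _ AS (A_l k N) _ (vdelta k (psrc w))).
congr (tens _ _); rewrite [LHS](@tensor_ract_tens _ _ _ _ (A_r k N) S).
by rewrite kS_elt_r.
Qed.
Lemma lact_tens3 c a w b : lact c (t3 a w b) = t3 (c * a) w b.
Proof.
rewrite /tens3 [LHS](@tensor_lact_tens _ _ _ _ AS (A_l k N)); congr (tens _ _).
exact: (@tensor_lact_tens _ _ _ _ (A_r k N) S).
Qed.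
Lemma ract_tens3 a w b c : ract (t3 a w b) c = t3 a w (b * c).
Proof. exact: (@tensor_ract_tens _ _ _ _ AS (A_l k N)). Qed.

Lemma tens3_ind (Q : Pbm k N n.+1 -> Prop) : Q 0 ->
  (forall a w b x, w \in amb N n.+1 -> Q x -> Q (t3 a w b + x)) -> forall x, Q x.
Proof.
move=> Q0 QS; apply: (@tens_ind _ _ _ _ AS (A_l k N)) => // m b x.
elim/(@tens_ind _ _ _ _ (A_r k N) S): m x => [|a c m IH] x Qx.
  by rewrite (lin0 (@tens_linl _ _ _ _ AS (A_l k N) b)) add0r.
rewrite tensDl -addrA; move: (IH x Qx); move: (_ + x) => {IH Qx}x Qx.
rewrite [c]kS_sum (lin_sum (@tens_linr _ _ _ _ (A_r k N) S a)).
rewrite (lin_sum (@tens_linl _ _ _ _ AS (A_l k N) b)).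
elim/big_rec: _ x Qx => [|u y _ IH] x Qx; rewrite ?add0r // -addrA.
rewrite tensZr -tensZl; apply: QS; first exact: ssvalP.
exact: IH.
Qed.

(** Two successive lifts through the two tensor products, the coordinates of the
    middle factor turning the family over the words into a linear map. *)
Lemma tens3_lift (V : lmodType k) (F : A -> qpath (Qx N) -> A -> V) :
  (forall w b, linear (fun a => F a w b)) -> (forall a w, linear (F a w)) ->
  (forall a (w : qpath (Qx N)) b, F (a * ev (ptgt w)) w b = F a w b) ->
  (forall a (w : qpath (Qx N)) b, F a w (ev (psrc w) * b) = F a w b) ->
  exists2 g : Pbm k N n.+1 -> V, linear g &
    forall a w b, w \in amb N n.+1 -> g (t3 a w b) = F a w b.
Proof.
move=> Fl Fr Fel Fer.
have Fvl a (w : qpath (Qx N)) b (c : kQ0 k N) : F (a * vert_A k N c) w b = c (ptgt w) *: F a w b.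
  rewrite -Fel -(mulrA a) ev_vert -scalerAr (linZ (Fl w b)).
  by congr (_ *: _); apply: Fel.
have Fvr a (w : qpath (Qx N)) b (c : kQ0 k N) : F a w (vert_A k N c * b) = c (psrc w) *: F a w b.
  rewrite -Fer (mulrA (ev _)) vert_ev -scalerAl (linZ (Fr a w)).
  by congr (_ *: _); apply: Fer.
have inner b : exists g : AS -> V, linear g /\
    forall a c, g (tens (M := A_r k N) (N := S) a c) = \sum_u c u *: F a (ssval u) b.
  have [||| g lg gE] := @tensor_lift _ _ _ _ (A_r k N) S V
      (fun a c => \sum_u c u *: F a (ssval u) b); last by exists g.
  - move=> c e x y; rewrite scaler_sumr -big_split; apply: eq_bigr => u _ /=.
    by rewrite (Fl (ssval u) b e x y) scalerDr !scalerA [_ * e]mulrC.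
  - move=> a e c c'; rewrite scaler_sumr -big_split; apply: eq_bigr => u _ /=.
    by rewrite !ffunE scalerDl scalerA.
  move=> a c c'; apply: eq_bigr => u _.
  by rewrite [ract _ _]/(a * vert_A k N c) Fvl scalerA !ffunE [c' u * _]mulrC.
pose G (m : AS) b := sval (cid (inner b)) m.
have Gl b : linear (G^~ b) by rewrite /G; case: (cid _) => g [].
have GE a c b : G (tens a c) b = \sum_u c u *: F a (ssval u) b.
  by rewrite /G; case: (cid _) => g [? gE] /=.
have [||| g lg gE] := @tensor_lift _ _ _ _ AS (A_l k N) V G.
- exact: Gl.
- move=> m e b b'; elim/(@tens_ind _ _ _ _ (A_r k N) S): m => [|a c m IH].
    by rewrite !(lin0 (Gl _)) scaler0 addr0.
  rewrite !(linD (Gl _)) IH scalerDr addrACA; congr (_ + _).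
  rewrite !GE scaler_sumr -big_split; apply: eq_bigr => u _ /=.
  by rewrite (Fr a (ssval u)) scalerDr !scalerA [_ * e]mulrC.
- move=> m c b; elim/(@tens_ind _ _ _ _ (A_r k N) S): m => [|a c' m IH].
    by rewrite ract0l !(lin0 (Gl _)).
  rewrite ractDl !(linD (Gl _)) IH; congr (_ + _).
  rewrite [ract _ _](@tensor_ract_tens _ _ _ _ (A_r k N) S) !GE.
  apply: eq_bigr => u _; rewrite [lact c b]/(vert_A k N c * b) Fvr scalerA.
  by rewrite !ffunE.
exists g => // a w b wa; rewrite /tens3 gE GE (bigD1 (SeqSub wa)) // big1 /=.
  by rewrite ffunE eqxx scale1r addr0.
move=> u; rewrite -val_eqE /= => nu.
by rewrite ffunE (negPf nu) scale0r.
Qed.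

Lemma tens3_free (G : Type) (w : G -> qpath (Qx N)) (tg sr : G -> 'I_N.+1) :
  (forall g, w g \in amb N n.+1) ->
  (forall u, u \in amb N n.+1 -> exists g, w g = u) -> injective w ->
  (forall g, tg g = ptgt (w g)) -> (forall g, sr g = psrc (w g)) ->
  corner_free ev tg sr (fun a g b => t3 a (w g) b).
Proof.
move=> wa aw winj tgE srE; split; first split=> *.
- exact: tens3_linl.
- exact: tens3_linr.
- by rewrite tgE tens3_evl.
- by rewrite srE tens3_evr.
- by rewrite lact_tens3.
- by rewrite ract_tens3.
- move=> Q Q0 QS; apply: tens3_ind => // a u b x /aw [g <-]; exact: QS.
move=> V F Fl Fr Fel Fer.
pose F' a u b := if pselect (exists g, w g = u) is left e
                 then F a (sval (cid e)) b else 0.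
have F'E a g b : F' a (w g) b = F a g b.
  rewrite /F'; case: pselect => [e|[]]; last by exists g.
  by case: (cid e) => g' /= /winj ->.
have [|||| f lf fE] := @tens3_lift V F'.
- move=> u b; rewrite /F'; case: pselect => [e|_]; first exact: Fl.
  exact: lin_cst0.
- move=> a u; rewrite /F'; case: pselect => [e|_]; first exact: Fr.
  exact: lin_cst0.
- move=> a u b; rewrite /F'; case: pselect => [e|//]; case: (cid e) => g /= <-.
  by rewrite -tgE Fel.
- move=> a u b; rewrite /F'; case: pselect => [e|//]; case: (cid e) => g /= <-.
  by rewrite -srE Fer.
by exists f => // a g b; rewrite fE ?F'E.
Qed.
End Tens3.

End Concrete.

(** * The words and the explicit formulas *)

Section CellWords.
Variables (k : fieldType) (N : nat).
Local Notation A := (algA k N).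
Local Notation ev := (@ev k N).
Local Notation arrA := (@arr_A k N).

Definition cell_word (n : nat) (c : cell N) : qpath (Qx N) :=
  let: Cell b s i := c in
  if s then if b then wsP n i else wsQ n i else if b then wP n i else wQ n i.

Lemma last_alt (a b : arrow N) n : asrc a = atgt b -> asrc b = atgt a ->
  last (atgt a) [seq asrc x | x <- alt a b n] = if odd n then asrc a else atgt a.
Proof.
elim: n a b => // n IH a b ab ba.
by rewrite /= {1}ab (IH b a ba ab) ba ab; case: odd.
Qed.

Lemma psrc_cell_word n c : psrc (cell_word n.+1 c) = cell_src n.+1 c.
Proof.
have lP m i := @last_alt (Ap i) (Aq i) m erefl erefl.
have lQ m i := @last_alt (Aq i) (Ap i) m erefl erefl.
case: c => [[] [] i]; rewrite /psrc /=;
  [move: (lP n i) | move: (lP n.+1 i) | move: (lQ n i) | move: (lQ n.+1 i)];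
  by rewrite /= => ->; case: odd.
Qed.

Lemma ptgt_cell_word n c : ptgt (cell_word n c) = cell_tgt c.
Proof. by case: c => [[] [] i]. Qed.

Lemma cell_word_inj n : injective (cell_word n.+2).
Proof.
(* The first letter p or q of a word of length at least 2 gives the index back. *)
pose index (l : seq (arrow N)) := match l with
  | Ap i :: _ | Aq i :: _ | As _ :: Ap i :: _ | As _ :: Aq i :: _ => Some i
  | _ => None end.
by move=> [[] [] i] [[] [] j] /(congr1 (@parr _)) // /(congr1 index) [->].
Qed.

Lemma cell_word_amb n c : cell_word n.+1 c \in amb N n.+1.
Proof. by case: c => [b t i]; have [] := words_in_amb n i; case: b; case: t. Qed.

Lemma amb_cell_word n u : u \in amb N n.+2 -> exists c, cell_word n.+2 c = u.
Proof.
case/flattenP => l /mapP [i _ ->]; rewrite !inE => /or4P[] /eqP->.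
- by exists (Cell true false i).
- by exists (Cell false false i).
- by exists (Cell true true i).
- by exists (Cell false true i).
Qed.

Lemma cell_word1 c : cell_word 1 c = parrow (cell_arrow c : arr (Qx N)).
Proof. by apply: val_inj; case: c => [[] [] i]. Qed.

Definition arrow_cell (a : A) (w : arrow N) (b : A) : Pbm k N 1 :=
  tens3 0 a (parrow (w : arr (Qx N))) b.
Definition word_cell n (a : A) (c : cell N) (b : A) : Pbm k N n.+1 :=
  tens3 n a (cell_word n.+1 c) b.

Lemma arrow_cell_free : corner_free ev (@atgt N) (@asrc N) arrow_cell.
Proof.
apply: tens3_free => //.
- by move=> w; apply: map_f; rewrite mem_enum.
- by move=> u /mapP [w _ ->]; exists w.
- by move=> w w' /(congr1 (@parr _)) [].
Qed.

Lemma word_cell_free n : corner_free ev (@cell_tgt N) (cell_src n.+2) (word_cell n.+1).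
Proof.
apply: tens3_free.
- exact: cell_word_amb.
- exact: amb_cell_word.
- exact: cell_word_inj.
- by move=> c; rewrite ptgt_cell_word.
- by move=> c; rewrite psrc_cell_word.
Qed.

Lemma word_cell0 a c b : word_cell 0 a c b = arrow_cell a (cell_arrow c) b.
Proof. by rewrite /word_cell cell_word1. Qed.

Lemma even_boundary m (D : Pbm k N m.+2 -> Pbm k N m.+1) : even_formulas D <->
  forall c, D (word_cell m.+1 1 c 1) = boundary arrA (word_cell m) false c.
Proof.
have bX b i := boundary_even_plain arrA (word_cell m) b i.
have bY b i := boundary_even_loop arrA (word_cell m) b i.
split=> [F c|F n i].
  case: c => [[] [] i]; have [eQ eP esP esQ] := F i.
  - exact: etrans esP (esym (bY true i)).
  - exact: etrans eP (esym (bX true i)).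
  - exact: etrans esQ (esym (bY false i)).
  - exact: etrans eQ (esym (bX false i)).
split.
- exact: etrans (F (Cell false false i)) (bX false i).
- exact: etrans (F (Cell true false i)) (bX true i).
- exact: etrans (F (Cell true true i)) (bY true i).
- exact: etrans (F (Cell false true i)) (bY false i).
Qed.

Lemma odd_boundary m (D : Pbm k N m.+2 -> Pbm k N m.+1) : odd_formulas D <->
  forall c, D (word_cell m.+1 1 c 1) = boundary arrA (word_cell m) true c.
Proof.
have bX b i := boundary_odd_plain arrA (word_cell m) b i.
have bY b i := boundary_odd_loop arrA (word_cell m) b i.
split=> [F c|F n i].
  case: c => [[] [] i]; have [eQ eP esP esQ] := F i.
  - exact: etrans esP (esym (bY true i)).
  - exact: etrans eP (esym (bX true i)).
  - exact: etrans esQ (esym (bY false i)).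
  - exact: etrans eQ (esym (bX false i)).
split.
- exact: etrans (F (Cell false false i)) (bX false i).
- exact: etrans (F (Cell true false i)) (bX true i).
- exact: etrans (F (Cell true true i)) (bY true i).
- exact: etrans (F (Cell false true i)) (bY false i).
Qed.

Lemma differentials_cell eps d :
  @differentials k N eps d <->
  cell_differential arrA (@vertex_cell k N) arrow_cell word_cell eps d.
Proof.
have u1 := vertex_cell_unit k N.
have t2l a : tens2 a 1 = lact a (tens2 (1 : A) 1) by rewrite lact_tens2 mulr1.
have t2r a : tens2 1 a = ract (tens2 (1 : A) 1) a by rewrite ract_tens2 mul1r.
split=> [[h1 h2 e f0 fe fo]|[h1 h2 e f0 fS]]; split=> //.
- by rewrite u1.
- by move=> w; rewrite u1 -t2l -t2r; apply: f0.
- move=> n c; case o: (odd n.+2); first exact: ((odd_boundary _).1 (fo n o)).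
  by apply: ((even_boundary _).1 (fe n _)); rewrite o.
- by rewrite -u1.
- by move=> w; rewrite t2l t2r -u1; apply: f0.
- by move=> m o; apply/even_boundary => c; rewrite fS (negPf o).
- by move=> m o; apply/odd_boundary => c; rewrite fS o.
Qed.

End CellWords.

Theorem theorem6p4 (k : fieldType) (N : nat) (hN : (0 < N)%N) :
  exists (eps : Pbm k N 0 -> diagbimod (algA k N))
         (d : forall n : nat, Pbm k N n.+1 -> Pbm k N n),
    [/\ differentials eps d,
        (forall eps' d', @differentials k N eps' d' ->
           (forall x, eps' x = eps x) /\ (forall n x, d' n x = d n x))
      & projective_resolution eps d].
Proof.
have R := algA_rels k N; have F0 := tens2_free k N.
have F1 := arrow_cell_free k N; have FE := @word_cell_free k N; have E0 := @word_cell0 k N.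
have [eps [d D]] := cell_differential_exists R F0 F1 FE E0.
exists eps, d; split.
- exact/differentials_cell.
- by move=> eps' d' /differentials_cell D'; exact: (cell_differential_uniq R F0 F1 FE D D').
apply: (cell_resolution R F0 F1 FE E0 D).
- exact: algA_ind.
- exact: q_retraction.
- exact: algA_derivation.
Qed.
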